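(* Let $T:X\to Y$ be a bijective linear operator between Archimedean vector lattices satisfying at least one of the following: (1) $X$ and $Y$ are Banach lattices; (2) $X$ is relatively uniformly complete and $Y$ is a normed vector lattice; (3) $X$ is a Dedekind $\sigma$-complete normed vector lattice and $Y$ is relatively uniformly complete; (4) $X$ is a Dedekind $\sigma$-complete normed vector lattice and $Y=X$. Then $T$ is disjointness preserving if and only if $T$ satisfies condition $(\beta)$.
   Context: All vector lattices are Archimedean; operators are not assumed continuous. For a subset $A$ of a vector lattice $X$, $A^d=\{x\in X: |x|\wedge|a|=0 \text{ for all } a\in A\}$ and $A^{dd}=(A^d)^d$. For $a,b\in X$ we write $a\lhd b$ if $\{a\}^{dd}\subseteq\{b\}^{dd}$. A linear operator $S$ satisfies condition $(\beta)$ if $Sa\lhd Sb$ whenever $a\lhd b$. A linear operator is disjointness preserving if it maps disjoint elements to disjoint elements. A vector lattice is relatively uniformly ($(r_u)$-) complete if every relatively uniformly Cauchy sequence is relatively uniformly convergent. *)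

(* Defs.v *)
From HB Require Import structures.
From mathcomp Require Import all_boot all_order all_algebra.
From mathcomp Require Import reals.
Set Implicit Arguments. Unset Strict Implicit. Unset Printing Implicit Defensive.
Import Order.TTheory GRing.Theory Num.Theory.
Local Open Scope ring_scope.

Record archVL (R : realType) (V : lmodType R) := ArchVL {
  vle : V -> V -> Prop;
  vsup : V -> V -> V;
  vle_refl : forall x, vle x x;
  vle_anti : forall x y, vle x y -> vle y x -> x = y;
  vle_trans : forall x y z, vle x y -> vle y z -> vle x z;
  vle_add : forall x y z, vle x y -> vle (x + z) (y + z);
  vle_scale : forall (a : R) x y, 0 <= a -> vle x y -> vle (a *: x) (a *: y);
  vsup_ubl : forall x y, vle x (vsup x y);
  vsup_ubr : forall x y, vle y (vsup x y);
  vsup_least : forall x y z, vle x z -> vle y z -> vle (vsup x y) z;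
  varchimedean : forall x y, vle 0 x -> (forall n : nat, vle (x *+ n) y) -> x = 0
}.

Section VL.
Variables (R : realType) (V : lmodType R) (L : archVL V).

Definition vinf (x y : V) : V := - vsup L (- x) (- y).
Definition vabs (x : V) : V := vsup L x (- x).

Definition vdisj (x y : V) : Prop := vinf (vabs x) (vabs y) = 0.

Definition dcompl (A : V -> Prop) : V -> Prop :=
  fun x => forall a, A a -> vdisj x a.

Definition bandgen (a : V) : V -> Prop := dcompl (dcompl (fun z => z = a)).

Definition vlhd (a b : V) : Prop := forall x, bandgen a x -> bandgen b x.

Definition ru_cauchy (u : nat -> V) : Prop :=
  exists e : V, vle L 0 e /\
    forall eps : R, 0 < eps -> exists N : nat, forall m n : nat,
      (N <= m)%N -> (N <= n)%N -> vle L (vabs (u n - u m)) (eps *: e).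

Definition ru_converges (u : nat -> V) (x : V) : Prop :=
  exists e : V, vle L 0 e /\
    forall eps : R, 0 < eps -> exists N : nat, forall n : nat,
      (N <= n)%N -> vle L (vabs (u n - x)) (eps *: e).

Definition ru_complete : Prop :=
  forall u : nat -> V, ru_cauchy u -> exists x, ru_converges u x.

Definition dedekind_sigma_complete : Prop :=
  forall (u : nat -> V) (b : V), (forall n, vle L (u n) b) ->
    exists s : V, (forall n, vle L (u n) s) /\
      (forall t, (forall n, vle L (u n) t) -> vle L s t).
End VL.

Record vlnorm (R : realType) (V : lmodType R) (L : archVL V) := VLNorm {
  vnorm : V -> R;
  vnorm_ge0 : forall x, 0 <= vnorm x;
  vnorm_eq0 : forall x, vnorm x = 0 -> x = 0;
  vnormZ : forall (a : R) x, vnorm (a *: x) = `|a| * vnorm x;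
  vnormD : forall x y, vnorm (x + y) <= vnorm x + vnorm y;
  vnorm_lattice : forall x y, vle L (vabs L x) (vabs L y) -> vnorm x <= vnorm y
}.

Definition norm_complete (R : realType) (V : lmodType R) (L : archVL V)
  (N : vlnorm L) : Prop :=
  forall u : nat -> V,
    (forall eps : R, 0 < eps -> exists M : nat, forall m n : nat,
        (M <= m)%N -> (M <= n)%N -> vnorm N (u n - u m) < eps) ->
    exists x : V, forall eps : R, 0 < eps -> exists M : nat, forall n : nat,
        (M <= n)%N -> vnorm N (u n - x) < eps.

Definition disj_preserving (R : realType) (V W : lmodType R)
  (LX : archVL V) (LY : archVL W) (T : V -> W) : Prop :=
  forall x y, vdisj LX x y -> vdisj LY (T x) (T y).

Definition cond_beta (R : realType) (V W : lmodType R)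
  (LX : archVL V) (LY : archVL W) (T : V -> W) : Prop :=
  forall a b, vlhd LX a b -> vlhd LY (T a) (T b).

(* Main.v *)
(* Let [S] be the inverse of [T].  If [T] and [S] both preserve disjointness, then [T]
   satisfies (beta); conversely (beta) forces [S] to preserve disjointness, because
   [c = |S u| /\ |S v|] satisfies [T c <| u] and [T c <| v].  Banach lattices and Dedekind
   sigma-complete lattices are r_u-complete, so (1) and (4) are instances of (2), and two
   facts remain.
   (A) If [X] is r_u-complete, [Y] is normed and [T] preserves disjointness, then so does
   [S].  A gliding hump makes [T] bounded on an order interval below some nonzero [g] under
   any given nonzero [h]; where [T] is bounded, [0 <= k <= a] implies [T k <| T a], by
   slicing [k] along the levels [(i/n) a].
   (B) If [X] is r_u-complete, [Y] is normed and [T] satisfies (beta), then [T] preserves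
   disjointness.  Suppose [0 <= u <= v], [u <> 0] and [S u], [S v] are disjoint.  Cutting
   [v] by the ratio [u/v] corresponds to cutting [S u] and [S v] into components, and the
   gliding hump gives a piece on which [T] is bounded below [S v].  There the binary
   expansion of [u/v] builds [z] in the band of [S v] with [T z = u], whereas [S u] is
   disjoint from that band.
   In (3), [S] preserves disjointness by (A) for [S] in one direction; in the other,
   projections onto principal bands of [X] show that [S] satisfies (beta), and (B) applies
   to [S]. *)
Require Import Defs.
From HB Require Import structures.
From mathcomp Require Import all_boot all_order all_algebra.
From mathcomp Require Import reals boolp classical_sets ring lra.
Set Implicit Arguments. Unset Strict Implicit. Unset Printing Implicit Defensive.
Import Order.TTheory GRing.Theory Num.Theory.
Local Open Scope ring_scope.

(** * Linear identities in modules *)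

Inductive lexpr (R : Type) :=
  | LVar of nat | LZero | LAdd of lexpr R & lexpr R | LOpp of lexpr R
  | LScale of R & lexpr R.
Arguments LVar {R}. Arguments LZero {R}.

Section LinearReflection.
Variables (R : comPzRingType) (V : lmodType R).

Fixpoint leval (env : seq V) (e : lexpr R) : V :=
  match e with
  | LVar n => nth 0 env n
  | LZero => 0
  | LAdd a b => leval env a + leval env b
  | LOpp a => - leval env a
  | LScale k a => k *: leval env a
  end.

Fixpoint lcoef (e : lexpr R) (i : nat) : R :=
  match e with
  | LVar n => if eqn n i then 1 else 0
  | LZero => 0
  | LAdd a b => lcoef a i + lcoef b i
  | LOpp a => - lcoef a i
  | LScale k a => k * lcoef a i
  end.

(** A nested conjunction, so that [/=] on a concrete environment leaves one scalar identity per
    atom. *)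
Fixpoint lcoef_eq (n : nat) (e f : lexpr R) : Prop :=
  match n with
  | 0 => True
  | n'.+1 => lcoef e n' = lcoef f n' /\ lcoef_eq n' e f
  end.

Lemma leval_coef (env : seq V) (e : lexpr R) :
  leval env e = \sum_(i < size env) lcoef e i *: nth 0 env i.
Proof.
elim: e => [n||a IHa b IHb|a IHa|k a IHa] /=.
- have [nlt|nge] := ltnP n (size env).
    rewrite (bigD1 (Ordinal nlt)) //= (_ : eqn n n) ?scale1r; last exact/eqnP.
    rewrite big1 ?addr0 // => i /eqP ine.
    case: eqnP => [ni|]; last by rewrite scale0r.
    by case: ine; apply: val_inj.
  rewrite nth_default // big1 // => i _.
  case: eqnP => [ni|]; last by rewrite scale0r.
  by move: nge; rewrite ni leqNgt ltn_ord.
- by rewrite big1 // => i _; rewrite scale0r.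
- by rewrite IHa IHb -big_split; apply: eq_bigr => i _; rewrite scalerDl.
- by rewrite IHa -sumrN; apply: eq_bigr => i _; rewrite scaleNr.
- by rewrite IHa scaler_sumr; apply: eq_bigr => i _; rewrite scalerA.
Qed.

Lemma leval_eq (env : seq V) (e f : lexpr R) :
  lcoef_eq (size env) e f -> leval env e = leval env f.
Proof.
rewrite !leval_coef; elim: (size env) => [|n IHn] /=; first by rewrite !big_ord0.
by rewrite !big_ord_recr /= => -[-> /IHn ->].
Qed.
End LinearReflection.

(* Atoms are compared up to conversion, since the same operation may occur with
   different structure instances. *)
Ltac lmod_index x env :=
  lazymatch env with
  | ?y :: ?env' =>
      match constr:(Set) with
      | _ => let _ := match constr:(Set) with _ => unify x y end in constr:(O)
      | _ => let n := lmod_index x env' in constr:(S n)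
      end
  end.

Ltac lmod_add x env :=
  match constr:(Set) with
  | _ => let _ := lmod_index x env in env
  | _ => constr:(x :: env)
  end.

Ltac lmod_atoms t env :=
  lazymatch t with
  | (?a + ?b)%R => let env' := lmod_atoms a env in lmod_atoms b env'
  | (- ?a)%R => lmod_atoms a env
  | (_ *: ?a)%R => lmod_atoms a env
  | (?a *+ _)%R => lmod_atoms a env
  | (0)%R => env
  | _ => lmod_add t env
  end.

Ltac lmod_reify R t env :=
  lazymatch t with
  | (?a + ?b)%R =>
      let a' := lmod_reify R a env in
      let b' := lmod_reify R b env in constr:(LAdd a' b')
  | (- ?a)%R => let a' := lmod_reify R a env in constr:(LOpp a')
  | (?k *: ?a)%R => let a' := lmod_reify R a env in constr:(LScale k a')
  | (0)%R => constr:(@LZero R)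
  | _ => let n := lmod_index t env in constr:(@LVar R n)
  end.

(* Decides linear identities in a module, atom by atom, with [field] for the coefficients. *)
Ltac lmod R :=
  rewrite -?scaler_nat;
  lazymatch goal with
  | |- @eq ?V ?s ?t =>
      let env0 := lmod_atoms s (@nil V) in
      let env := lmod_atoms t env0 in
      let s' := lmod_reify (GRing.PzRing.sort R) s env in
      let t' := lmod_reify (GRing.PzRing.sort R) t env in
      apply: (@leval_eq _ _ env s' t'); rewrite /=;
      repeat (split; [by [] || by ring || by field | ]); exact: I
  end.

(** * Archimedean vector lattices *)

Section VectorLattice.
Variables (R : realType) (V : lmodType R) (L : archVL V).
Local Notation "x <=v y" := (vle L x y) (at level 70).
Local Notation "`| x |v" := (vabs L x) (format "`| x |v").
Local Notation inf := (vinf L).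
Local Notation sup := (vsup L).
Local Notation disj := (vdisj L).

Definition vpos (x : V) : V := sup x 0.
Local Notation neg x := (vpos (- x)).

Lemma vle_sub (x y : V) : 0 <=v y - x -> x <=v y.
Proof. by move/(vle_add x); rewrite add0r subrK. Qed.

(** The lattice content of an inequality sits in [a <=v b]; the identity between differences is left
    to [lmod]. *)
Lemma vle_lin (a b x y : V) : a <=v b -> y - x = b - a -> x <=v y.
Proof.
by move=> ab E; apply: vle_sub; rewrite E -(subrr a); apply: vle_add.
Qed.

Lemma vle_addb (a b c d : V) : a <=v b -> c <=v d -> a + c <=v b + d.
Proof.
move=> ab cd; apply: vle_trans (vle_add c ab) _.
by rewrite ![b + _]addrC; apply: vle_add.
Qed.

Lemma vle_half (x y : V) : x *+ 2 <=v y *+ 2 -> x <=v y.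
Proof.
move=> H; have h : 0 <= 2^-1 :> R by rewrite invr_ge0.
by apply: (vle_lin (vle_scale h H)); lmod R.
Qed.

Lemma vscale_ge0 (k : R) (x : V) : 0 <= k -> 0 <=v x -> 0 <=v k *: x.
Proof. by move=> k0 /(vle_scale k0); rewrite scaler0. Qed.

Lemma vscale_le (k l : R) (x : V) : k <= l -> 0 <=v x -> k *: x <=v l *: x.
Proof.
rewrite -subr_ge0 => k0 x0; apply: (vle_lin (vscale_ge0 k0 x0)); lmod R.
Qed.

Lemma vadd_ge0 (x y : V) : 0 <=v x -> 0 <=v y -> 0 <=v x + y.
Proof. by move=> x0 /(vle_addb x0); rewrite add0r. Qed.

Lemma vle_scale_inv (k : R) (x y : V) : 0 < k -> k *: x <=v y -> x <=v k^-1 *: y.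
Proof.
move=> k0; have /vle_scale H : 0 <= k^-1 by rewrite invr_ge0 ltW.
by move=> /H; rewrite scalerA mulVf ?scale1r ?gt_eqF.
Qed.

Lemma vmulrn_ge0 (n : nat) (x : V) : 0 <=v x -> 0 <=v x *+ n.
Proof. by move=> x0; rewrite -scaler_nat; apply: vscale_ge0 => //; apply: ler0n. Qed.

Lemma vinf_lel (x y : V) : inf x y <=v x.
Proof. apply: (vle_lin (vsup_ubl L (- x) (- y))); rewrite /vinf; lmod R. Qed.

Lemma vinf_ler (x y : V) : inf x y <=v y.
Proof. apply: (vle_lin (vsup_ubr L (- x) (- y))); rewrite /vinf; lmod R. Qed.

Lemma vinf_greatest (x y z : V) : z <=v x -> z <=v y -> z <=v inf x y.
Proof.
move=> zx zy; have H : sup (- x) (- y) <=v - z.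
  by apply: vsup_least; [apply: (vle_lin zx)|apply: (vle_lin zy)]; lmod R.
apply: (vle_lin H); rewrite /vinf; lmod R.
Qed.

Lemma vinf_ge0 (x y : V) : 0 <=v x -> 0 <=v y -> 0 <=v inf x y.
Proof. exact: vinf_greatest. Qed.

Lemma vsup_inf (x y : V) : sup x y + inf x y = x + y.
Proof.
apply: (@vle_anti _ _ L).
  have H : sup x y <=v x + y - inf x y.
    apply: vsup_least.
      by apply: (vle_lin (vinf_ler x y)); lmod R.
    by apply: (vle_lin (vinf_lel x y)); lmod R.
  by apply: (vle_lin H); lmod R.
have H : x + y - sup x y <=v inf x y.
  apply: vinf_greatest.
    by apply: (vle_lin (vsup_ubr L x y)); lmod R.
  by apply: (vle_lin (vsup_ubl L x y)); lmod R.
by apply: (vle_lin H); lmod R.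
Qed.

Lemma vinf_addr (x y z : V) : 0 <=v x -> 0 <=v y -> 0 <=v z ->
  inf x (y + z) <=v inf x y + inf x z.
Proof.
move=> x0 y0 z0; have i0 := vinf_ge0 x0 z0.
have H : inf x (y + z) - inf x z <=v inf x y.
  apply: vinf_greatest.
    by apply: (vle_lin (vle_addb (vinf_lel x (y + z)) i0)); lmod R.
  have H : inf x (y + z) - y <=v inf x z.
    apply: vinf_greatest.
      by apply: (vle_lin (vle_addb (vinf_lel x (y + z)) y0)); lmod R.
    by apply: (vle_lin (vinf_ler x (y + z))); lmod R.
  by apply: (vle_lin H); lmod R.
by apply: (vle_lin H); lmod R.
Qed.

Lemma vle_abs (x : V) : x <=v `|x|v. Proof. exact: vsup_ubl. Qed.
Lemma vleN_abs (x : V) : - x <=v `|x|v. Proof. exact: vsup_ubr. Qed.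

Lemma vabs_le (x y : V) : x <=v y -> - x <=v y -> `|x|v <=v y.
Proof. exact: vsup_least. Qed.

Lemma vabs_ge0 (x : V) : 0 <=v `|x|v.
Proof.
by apply: vle_half; apply: (vle_lin (vle_addb (vle_abs x) (vleN_abs x))); lmod R.
Qed.

Lemma vabsN (x : V) : `|- x|v = `|x|v.
Proof.
by rewrite /vabs opprK; apply: (@vle_anti _ _ L); apply: vsup_least;
  do ?[exact: vsup_ubl|exact: vsup_ubr].
Qed.

Lemma vge0_abs (x : V) : 0 <=v x -> `|x|v = x.
Proof.
move=> x0; apply: (@vle_anti _ _ L); last exact: vle_abs.
apply: vabs_le; first exact: vle_refl.
by apply: (vle_lin (vle_addb x0 x0)); lmod R.
Qed.

Lemma vabs_id (x : V) : `| `|x|v |v = `|x|v.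
Proof. exact: vge0_abs (vabs_ge0 x). Qed.

Lemma vabs0 : vabs L 0 = 0.
Proof. exact: vge0_abs (vle_refl _ _). Qed.

Lemma vabs_eq0 (x : V) : `|x|v = 0 -> x = 0.
Proof.
move=> E; apply: (@vle_anti _ _ L); rewrite -E; first exact: vle_abs.
by have := vleN_abs x; rewrite E => H; apply: (vle_lin H); lmod R.
Qed.

Lemma vabsD (x y : V) : `|x + y|v <=v `|x|v + `|y|v.
Proof.
apply: vabs_le; first exact: vle_addb (vle_abs _) (vle_abs _).
by rewrite opprD; apply: vle_addb (vleN_abs _) (vleN_abs _).
Qed.

Lemma vabsB (x y : V) : `|x - y|v <=v `|x|v + `|y|v.
Proof. by rewrite -(vabsN y); apply: vabsD. Qed.

Lemma vdistC (x y : V) : `|x - y|v = `|y - x|v.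
Proof. by rewrite -vabsN opprB. Qed.

Lemma vabsZ_le (k : R) (x : V) : `|k *: x|v <=v `|k| *: `|x|v.
Proof.
have [k0|k0] := lerP 0 k.
  rewrite ger0_norm //; apply: vabs_le; first exact: vle_scale k0 (vle_abs x).
  by apply: (vle_lin (vle_scale k0 (vleN_abs x))); lmod R.
have k1 : 0 <= - k by rewrite oppr_ge0 ltW.
rewrite ltr0_norm //; apply: vabs_le.
  by apply: (vle_lin (vle_scale k1 (vleN_abs x))); lmod R.
by apply: (vle_lin (vle_scale k1 (vle_abs x))); lmod R.
Qed.

Lemma vabsZ (k : R) (x : V) : `|k *: x|v = `|k| *: `|x|v.
Proof.
apply: (@vle_anti _ _ L); first exact: vabsZ_le.
have [->|k0] := eqVneq k 0; first by rewrite normr0 !scale0r; apply: vabs_ge0.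
have H := vle_scale (normr_ge0 k) (vabsZ_le k^-1 (k *: x)).
have k1 : k != 0 by [].
move: H; rewrite normfV !scalerA mulfV ?normr_eq0 // mulVf // !scale1r.
by [].
Qed.

Lemma vpos_ge0 (x : V) : 0 <=v vpos x. Proof. exact: vsup_ubr. Qed.
Lemma vle_pos (x : V) : x <=v vpos x. Proof. exact: vsup_ubl. Qed.

Lemma vpos_le (x y : V) : x <=v y -> 0 <=v y -> vpos x <=v y.
Proof. exact: vsup_least. Qed.

Lemma vpos_mono (x y : V) : x <=v y -> vpos x <=v vpos y.
Proof.
by move=> xy; apply: vpos_le (vpos_ge0 y); apply: vle_trans xy (vle_pos y).
Qed.

Lemma vpos_le0 (x : V) : x <=v 0 -> vpos x = 0.
Proof.
move=> x0; apply: (@vle_anti _ _ L); last exact: vpos_ge0.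
by apply: vpos_le => //; apply: vle_refl.
Qed.

Lemma vpos_eq0 (x : V) : vpos x = 0 -> x <=v 0.
Proof. by move=> <-; apply: vle_pos. Qed.

Lemma vge0_pos (x : V) : 0 <=v x -> vpos x = x.
Proof.
move=> x0; apply: (@vle_anti _ _ L); last exact: vle_pos.
by apply: vpos_le => //; apply: vle_refl.
Qed.

Lemma vpos_neg (x : V) : x = vpos x - neg x.
Proof.
apply: (@vle_anti _ _ L).
  have H : neg x <=v vpos x - x.
    apply: vpos_le; first by apply: (vle_lin (vpos_ge0 x)); lmod R.
    by apply: (vle_lin (vle_pos x)); lmod R.
  by apply: (vle_lin H); lmod R.
have H : vpos x <=v x + neg x.
  apply: vpos_le; first by apply: (vle_lin (vpos_ge0 (- x))); lmod R.
  by apply: (vle_lin (vle_pos (- x))); lmod R.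
by apply: (vle_lin H); lmod R.
Qed.

Lemma vpos_le_abs (x : V) : vpos x <=v `|x|v.
Proof. exact: vpos_le (vle_abs x) (vabs_ge0 x). Qed.

Lemma vneg_le_abs (x : V) : neg x <=v `|x|v.
Proof. by rewrite -(vabsN x); apply: vpos_le_abs. Qed.

Lemma vdisjP (x y : V) :
  disj x y <-> forall d, 0 <=v d -> d <=v `|x|v -> d <=v `|y|v -> d = 0.
Proof.
split=> [xy d d0 dx dy | H].
  by apply: (@vle_anti _ _ L) => //; rewrite -xy; apply: vinf_greatest.
apply: H; [exact: vinf_ge0 (vabs_ge0 _) (vabs_ge0 _)|exact: vinf_lel|exact: vinf_ler].
Qed.

Lemma vdisjC (x y : V) : disj x y -> disj y x.
Proof. by move=> /vdisjP H; apply/vdisjP => d d0 dx dy; apply: H. Qed.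

Lemma vdisj_le (x x' y : V) : `|x'|v <=v `|x|v -> disj x y -> disj x' y.
Proof.
move=> x'x /vdisjP H; apply/vdisjP => d d0 dx dy; apply: H => //.
exact: vle_trans x'x.
Qed.

Lemma vdisj_le2 (x x' y y' : V) : `|x'|v <=v `|x|v -> `|y'|v <=v `|y|v ->
  disj x y -> disj x' y'.
Proof.
by move=> xx yy H; apply: (vdisj_le xx); apply: vdisjC; apply: (vdisj_le yy); apply: vdisjC.
Qed.

Lemma vdisj0 (y : V) : disj 0 y.
Proof. by apply/vdisjP => d d0; rewrite vabs0 => dx _; apply: (@vle_anti _ _ L). Qed.

Lemma vdisjN (x y : V) : disj x y -> disj (- x) y.
Proof. by apply: vdisj_le; rewrite vabsN; apply: vle_refl. Qed.

Lemma vdisjxx (x : V) : disj x x -> x = 0.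
Proof.
move=> /vdisjP H; apply: vabs_eq0; apply: H; first exact: vabs_ge0.
  exact: vle_refl.
exact: vle_refl.
Qed.

Lemma vdisj_absl (x y : V) : disj `|x|v y <-> disj x y.
Proof. by split; apply: vdisj_le; rewrite vabs_id; apply: vle_refl. Qed.

Lemma vdisjD (x y z : V) : disj x z -> disj y z -> disj (x + y) z.
Proof.
move=> xz yz; apply: (@vle_anti _ _ L); last exact: vinf_ge0 (vabs_ge0 _) (vabs_ge0 _).
have H := vinf_addr (vabs_ge0 z) (vabs_ge0 x) (vabs_ge0 y).
have [zx zy] := (vdisjC xz, vdisjC yz); move: H; rewrite zx zy addr0; apply: vle_trans.
apply: vinf_greatest; first exact: vinf_ler.
exact: vle_trans (vinf_lel _ _) (vabsD x y).
Qed.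

Lemma vdisjB (x y z : V) : disj x z -> disj y z -> disj (x - y) z.
Proof. by move=> xz yz; apply: vdisjD => //; apply: vdisjN. Qed.

Lemma vdisjMn (n : nat) (x y : V) : disj x y -> disj (x *+ n) y.
Proof.
move=> xy; elim: n => [|n IHn]; first by rewrite mulr0n; apply: vdisj0.
by rewrite mulrS; apply: vdisjD.
Qed.

Lemma vdisjZ (k : R) (x y : V) : disj x y -> disj (k *: x) y.
Proof.
move=> xy; have [n kn] : exists n : nat, `|k| <= n%:R.
  by exists (Num.bound `|k|); apply: ltW; apply: archi_boundP.
apply: vdisj_le (vdisjMn n xy); rewrite -scaler_nat !vabsZ.
by apply: vscale_le (vabs_ge0 x); rewrite [`|n%:R|]ger0_norm.
Qed.

Lemma vdisjZ_le (k : R) (x x' y : V) :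
  `|x'|v <=v k *: `|x|v -> disj x y -> disj x' y.
Proof.
move=> H /(vdisjZ `|k|); apply: vdisj_le; apply: vle_trans H _.
by rewrite vabsZ normr_id; apply: vscale_le (vabs_ge0 x); apply: ler_norm.
Qed.

Lemma vdisj_sum (I : Type) (r : seq I) (P : pred I) (F : I -> V) (y : V) :
  (forall i, P i -> disj (F i) y) -> disj (\sum_(i <- r | P i) F i) y.
Proof.
move=> H; apply: (big_ind (fun x => disj x y)) => //; first exact: vdisj0.
by move=> a b; apply: vdisjD.
Qed.

(** Cancels a disjoint summand: [m] is below its own meet with [s + r], and by [vinf_addr] the share
    of [r] in that meet is zero. *)
Lemma vle_disj (m s r : V) : 0 <=v m -> 0 <=v s -> 0 <=v r ->
  m <=v s + r -> disj m r -> m <=v s.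
Proof.
move=> m0 s0 r0 msr; rewrite /vdisj !vge0_abs // => mr.
have H := vinf_addr m0 s0 r0; rewrite mr addr0 in H.
apply: vle_trans (vinf_ler m s); apply: vle_trans H.
by apply: vinf_greatest => //; apply: vle_refl.
Qed.

Lemma vdisj_le_sum (x y : V) : disj x y -> `|x|v <=v `|x + y|v.
Proof.
move=> xy; apply: (@vle_disj _ _ `|y|v); do ?exact: vabs_ge0.
  by rewrite -[x in X in X <=v _](addrK y); apply: vabsB.
by apply/vdisj_absl; apply: vdisjC; apply/vdisj_absl; apply: vdisjC.
Qed.

Lemma vdisj_lub (x y z : V) : 0 <=v x -> 0 <=v y -> disj x y ->
  x <=v z -> y <=v z -> x + y <=v z.
Proof.
move=> x0 y0; rewrite /vdisj !vge0_abs // => xy xz yz.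
by rewrite -vsup_inf xy addr0; apply: vsup_least.
Qed.

Lemma vdisj_absD (x y : V) : disj x y -> `|x + y|v = `|x|v + `|y|v.
Proof.
move=> xy; apply: (@vle_anti _ _ L); first exact: vabsD.
apply: vdisj_lub; do ?exact: vabs_ge0.
- by rewrite /vdisj !vabs_id.
- exact: vdisj_le_sum.
- by rewrite addrC; apply: vdisj_le_sum; apply: vdisjC.
Qed.

Lemma vdisj_absB (x y : V) : disj x y -> `|x - y|v = `|x|v + `|y|v.
Proof.
move=> xy; rewrite vdisj_absD ?vabsN //.
by apply: vdisjC; apply: vdisjN; apply: vdisjC.
Qed.

(** Since [- x <=v y], the negative part of [x] lies below the moduli of both [x] and [y], so it
    vanishes. *)
Lemma vdisj_ge0 (x y : V) : disj x y -> 0 <=v x + y -> 0 <=v x.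
Proof.
move=> xy s0; have E : neg x = 0.
  move/vdisjP: xy; apply; first exact: vpos_ge0.
    exact: vneg_le_abs.
  apply: vpos_le (vabs_ge0 y); apply: vle_trans (vle_abs y).
  by apply: (vle_lin s0); lmod R.
by rewrite (vpos_neg x) E subr0; apply: vpos_ge0.
Qed.

(** Removing the meet of both parts from [vpos x] still leaves an upper bound of [x] and [0], so the
    meet is at most zero. *)
Lemma vpos_disj (x : V) : disj (vpos x) (neg x).
Proof.
rewrite /vdisj !vge0_abs; do ?exact: vpos_ge0.
apply: (@vle_anti _ _ L); last exact: vinf_ge0 (vpos_ge0 _) (vpos_ge0 _).
have H : vpos x <=v vpos x - inf (vpos x) (neg x).
  apply: vpos_le.
    rewrite {1}(vpos_neg x).
    by apply: (vle_lin (vinf_ler (vpos x) (neg x))); lmod R.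
  by apply: (vle_lin (vinf_lel (vpos x) (neg x))); lmod R.
by apply: (vle_lin H); lmod R.
Qed.

Lemma vabs_pos_neg (x : V) : `|x|v = vpos x + neg x.
Proof.
rewrite {1}(vpos_neg x) vdisj_absB ?(vge0_abs (vpos_ge0 _)) //.
exact: vpos_disj.
Qed.

(** With [eps] equal to [1/(n+1)], all multiples of the positive part of [x - y] stay below [e]; the
    Archimedean axiom applies. *)
Lemma vle_eps (x y e : V) : 0 <=v e ->
  (forall eps : R, 0 < eps -> x <=v y + eps *: e) -> x <=v y.
Proof.
move=> e0 H; have E : vpos (x - y) = 0.
  apply: (@varchimedean _ _ L) (vpos_ge0 _) _ => n; apply: vle_trans (_ : _ <=v e) => [|].
    have n0 : 0 < n.+1%:R^-1 :> R by rewrite invr_gt0.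
    have H1 : vpos (x - y) <=v n.+1%:R^-1 *: e.
      apply: vpos_le; first by apply: (vle_lin (H _ n0)); lmod R.
      exact: vscale_ge0 (ltW n0) e0.
    have H2 := vle_scale (ler0n R n.+1) H1.
    rewrite scalerA mulfV ?scale1r ?pnatr_eq0 // scaler_nat in H2.
    apply: vle_trans H2; rewrite -!scaler_nat; apply: vscale_le (vpos_ge0 _).
    by rewrite ler_nat.
  exact: vle_refl.
by move/vpos_eq0: E => H1; apply: (vle_lin H1); lmod R.
Qed.

(** Disjoint complements are closed under relatively uniform limits: a common lower bound of [x] and
    [w] is disjoint from [z], hence at most [eps *: e]. *)
Lemma vdisj_lim (x w e : V) : 0 <=v e ->
  (forall eps : R, 0 < eps -> exists2 z, `|x - z|v <=v eps *: e & disj z w) ->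
  disj x w.
Proof.
move=> e0 H; apply/vdisjP => d d0 dx dw.
apply: (@vle_anti _ _ L) => //; apply: (vle_eps e0) => eps eps0.
have [z xz zw] := H _ eps0; rewrite add0r.
apply: (@vle_disj _ _ `|z|v) => //.
- exact: vscale_ge0 (ltW eps0) e0.
- exact: vabs_ge0.
- apply: vle_trans dx _; apply: vle_trans (vle_add `|z|v xz).
  by rewrite -[x in X in X <=v _](subrK z); apply: vabsD.
- apply: vdisj_le2 (vdisjC zw); rewrite ?vabs_id ?(vge0_abs d0) //; exact: vle_refl.
Qed.

(** Bounds the height of one layer in [dp_layers]: the meet is disjoint from the overflow
    [(p - s)^+], and [p^+] is at most [s] plus that overflow. *)
Lemma vpos_inf_le (p s : V) : 0 <=v s ->
  inf (vpos p) (vpos (s - p)) <=v s.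
Proof.
move=> s0; set m := vinf L _ _.
have m0 : 0 <=v m by apply: vinf_ge0; apply: vpos_ge0.
apply: (@vle_disj _ _ (vpos (p - s))) => //; first exact: vpos_ge0.
  apply: vle_trans (vinf_lel _ _) _; apply: vpos_le.
    by apply: (vle_lin (vle_pos (p - s))); lmod R.
  exact: vadd_ge0 s0 (vpos_ge0 _).
have := vpos_disj (s - p); rewrite opprB; apply: vdisj_le.
by rewrite !vge0_abs //; [apply: vinf_ler | apply: vpos_ge0].
Qed.

Lemma vinf_sub_disj (a b : V) :
  disj (a - inf a b) (b - inf a b).
Proof.
rewrite /vdisj !vge0_abs; last 2 first.
- by apply: (vle_lin (vinf_ler a b)); lmod R.
- by apply: (vle_lin (vinf_lel a b)); lmod R.
have i0 : vle L 0 (inf (a - inf a b) (b - inf a b)).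
  by apply: vinf_ge0; [apply: (vle_lin (vinf_lel a b))|apply: (vle_lin (vinf_ler a b))]; lmod R.
apply: (@vle_anti _ _ L) i0; have H : vle L (inf (a - inf a b) (b - inf a b) + inf a b) (inf a b).
  apply: vinf_greatest.
    by apply: (vle_lin (vinf_lel (a - inf a b) (b - inf a b))); lmod R.
  by apply: (vle_lin (vinf_ler (a - inf a b) (b - inf a b))); lmod R.
by apply: (vle_lin H); lmod R.
Qed.

(** Riesz decomposition for [z] of arbitrary sign: its positive and negative parts are cut
    separately by meets with [p] and [q]. *)
Lemma vdisj_decomp (z p q : V) : 0 <=v p -> 0 <=v q -> disj p q ->
  `|z|v <=v p + q ->
  exists z1 z2, [/\ z = z1 + z2, `|z1|v <=v p & `|z2|v <=v q].
Proof.
move=> p0 q0 pq zpq.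
have pos_decomp x : 0 <=v x -> x <=v `|z|v -> x = inf x p + inf x q.
  move=> x0 xz; apply: (@vle_anti _ _ L).
    apply: vle_trans (vinf_addr x0 p0 q0); apply: vinf_greatest; first exact: vle_refl.
    exact: vle_trans zpq.
  apply: vdisj_lub; do ?exact: vinf_ge0; do ?exact: vinf_lel.
  by apply: vdisj_le2 pq; rewrite !vge0_abs //; do ?exact: vinf_ler; exact: vinf_ge0.
have bound x r : 0 <=v r -> `|inf (vpos x) r - inf (neg x) r|v <=v r.
  move=> r0; have [i0 j0] := (vinf_ge0 (vpos_ge0 x) r0, vinf_ge0 (vpos_ge0 (- x)) r0).
  apply: vabs_le.
    by apply: (vle_lin (vle_addb (vinf_ler (vpos x) r) j0)); lmod R.
  by apply: (vle_lin (vle_addb (vinf_ler (neg x) r) i0)); lmod R.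
exists (inf (vpos z) p - inf (neg z) p), (inf (vpos z) q - inf (neg z) q).
split; [|exact: bound|exact: bound].
rewrite {1}(vpos_neg z) {1}[vpos z](pos_decomp _ (vpos_ge0 _) (vpos_le_abs _)).
rewrite {1}[neg z](pos_decomp _ (vpos_ge0 _) (vneg_le_abs _)); lmod R.
Qed.

(** Replaces inclusion of double complements by reversed inclusion of single ones, the form in which
    [vlhd] is handled below. *)
Lemma vlhdP (a b : V) : vlhd L a b <-> forall w, disj w b -> disj w a.
Proof.
split=> [H w wb | H x xa w wb].
  apply: vdisjC; apply: (H a); first by move=> y ya; apply: vdisjC; apply: ya.
  by move=> _ ->.
apply: xa => _ ->; apply: H; by apply: wb.
Qed.

Lemma vlhd_trans (a b c : V) : vlhd L a b -> vlhd L b c -> vlhd L a c.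
Proof. by move=> ab bc x /ab /bc. Qed.

Lemma vlhd_le (k : R) (a b : V) : `|a|v <=v k *: `|b|v -> vlhd L a b.
Proof.
move=> ab; apply/vlhdP => w wb; apply: vdisjC.
exact: vdisjZ_le ab (vdisjC wb).
Qed.

Lemma vlhd_abs_le (a b : V) : `|a|v <=v `|b|v -> vlhd L a b.
Proof. by rewrite -[X in _ <=v X]scale1r; apply: vlhd_le. Qed.

Lemma vlhd_disj (a b a' b' : V) : vlhd L a a' -> vlhd L b b' -> disj a' b' ->
  disj a b.
Proof.
move=> /vlhdP aa /vlhdP bb ab; apply: bb; apply: vdisjC; apply: aa.
exact: vdisjC.
Qed.

Lemma vlhdD (a b c : V) : vlhd L a c -> vlhd L b c -> vlhd L (a + b) c.
Proof.
move=> /vlhdP ac /vlhdP bc; apply/vlhdP => w wc.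
by apply: vdisjC; apply: vdisjD; apply: vdisjC; auto.
Qed.

Lemma vlhdZ (k : R) (a b : V) : vlhd L a b -> vlhd L (k *: a) b.
Proof.
move=> /vlhdP ac; apply/vlhdP => w wc.
by apply: vdisjC; apply: vdisjZ; apply: vdisjC; auto.
Qed.

Lemma vlhdB (a b c : V) : vlhd L a c -> vlhd L b c -> vlhd L (a - b) c.
Proof. by move=> ac bc; rewrite -[- b]scaleN1r; apply: vlhdD => //; apply: vlhdZ. Qed.

End VectorLattice.

(** * Norms, relatively uniform series and the gliding hump *)

Section LatticeNorm.
Variables (R : realType) (V : lmodType R) (L : archVL V) (N : vlnorm L).

Lemma vnormN (x : V) : vnorm N (- x) = vnorm N x.
Proof. by rewrite -scaleN1r vnormZ normrN1 mul1r. Qed.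

Lemma vnorm0 : vnorm N 0 = 0.
Proof. by rewrite -(scale0r 0) vnormZ normr0 mul0r. Qed.

Lemma vnorm_le (x y : V) : vle L 0 x -> vle L x y -> vnorm N x <= vnorm N y.
Proof.
move=> x0 xy; apply: vnorm_lattice; rewrite !vge0_abs //.
exact: vle_trans xy.
Qed.

Lemma vnorm_disj (x y : V) : vdisj L x y -> vnorm N x <= vnorm N (x + y).
Proof. by move=> xy; apply: vnorm_lattice; apply: vdisj_le_sum. Qed.

Lemma vnorm_arch_eq0 (x : V) (C : R) :
  (forall n, n%:R * vnorm N x <= C) -> x = 0.
Proof.
move=> H; apply: (@vnorm_eq0 _ _ _ N); apply/eqP; rewrite eq_le vnorm_ge0 andbT leNgt.
apply/negP => x0; have := archi_boundP (normr_ge0 (C / vnorm N x)).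
rewrite ltNge => /negP; apply; apply: le_trans (_ : (Num.bound `|C / vnorm N x|)%:R <= C / vnorm N x) _ => //.
  by rewrite ler_pdivlMr.
exact: ler_norm.
Qed.
End LatticeNorm.

(** The factor 2 matches the geometric tail in [ru_series]. *)
Lemma half_pow_small (R : realType) (eps : R) : 0 < eps ->
  exists N, forall n, (N <= n)%N -> 2^-1 ^+ n * 2 <= eps.
Proof.
move=> e0; exists (Num.bound (2 / eps)) => n Nn.
have e2 : 0 <= 2 / eps by rewrite divr_ge0 // ltW.
have H : 2 / eps <= 2 ^+ n.
  apply: le_trans (ltW (archi_boundP e2)) _.
  rewrite -natrX ler_nat; apply: leq_trans Nn _; exact: ltnW (ltn_expl _ _).
rewrite ler_pdivrMr // in H; rewrite exprVn mulrC ler_pdivrMr ?exprn_gt0 //.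
by rewrite mulrC.
Qed.

Lemma half_pow_ge0 (R : realType) (n : nat) : 0 <= 2^-1 ^+ n :> R.
Proof. by rewrite exprn_ge0 // invr_ge0. Qed.

Section RelativelyUniform.
Variables (R : realType) (V : lmodType R) (L : archVL V).
Local Notation "x <=v y" := (vle L x y) (at level 70).
Local Notation "`| x |v" := (vabs L x) (format "`| x |v").

Lemma ru_series (e : V) (z : nat -> V) : ru_complete L -> 0 <=v e ->
  (forall n, `|z n.+1 - z n|v <=v 2^-1 ^+ n *: e) ->
  exists x, forall n, `|x - z n|v <=v (2^-1 ^+ n * 2) *: e.
Proof.
move=> cpl e0 step.
have tail n k : `|z (n + k)%N - z n|v <=v (2^-1 ^+ n * 2) *: e.
  (* The subtracted term is what makes the induction on [k] close. *)
  apply: (@vle_trans _ _ L _ ((2^-1 ^+ n * 2 - 2^-1 ^+ (n + k) * 2) *: e)); last first.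
    apply: vscale_le => //; rewrite gerBl mulr_ge0 //; exact: half_pow_ge0.
  elim: k => [|k IHk]; first by rewrite addn0 !subrr scale0r vabs0; apply: vle_refl.
  rewrite addnS -(subrKA (z (n + k)%N)); apply: vle_trans (vabsD _ _ _) _.
  apply: (vle_lin (vle_addb (step (n + k)%N) IHk)).
  by rewrite exprS; move: (2^-1 ^+ n) (2^-1 ^+ (n + k)) => a b; lmod R.
have [] := cpl z.
  exists e; split=> // eps eps0; have [N HN] := half_pow_small eps0.
  exists N => m n Nm Nn; wlog mn : m n Nm Nn / (m <= n)%N.
    by move=> H; have [/H|/ltnW/H] := leqP m n; [apply|rewrite vdistC; apply].
  rewrite -(subnKC mn); apply: vle_trans (tail _ _) _.
  by apply: vscale_le => //; apply: HN.
(* The limit may come with another regulator [e']; [vle_eps] removes it and keeps the bound in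
   [e]. *)
move=> x [e' [e'0 lim]]; exists x => n; apply: (vle_eps e'0) => eps eps0.
have [N HN] := lim eps eps0.
rewrite -(subrKA (z (n + N)%N)); apply: vle_trans (vabsD _ _ _) _.
rewrite addrC; apply: vle_addb; first exact: tail.
by rewrite vdistC; apply: HN; apply: leq_addl.
Qed.

End RelativelyUniform.

Section UniformBoundedness.
Variables (R : realType) (V W : lmodType R) (LX : archVL V) (LY : archVL W).
Variables (NY : vlnorm LY) (T : {linear V -> W}).
Local Notation "x <=v y" := (vle LX x y) (at level 70).
Local Notation "`| x |v" := (vabs LX x) (format "`| x |v").

(** The last premise confines [x] to the ideal generated by [g]: the gliding hump yields boundedness
    only locally. *)
Definition bounded_below (e g : V) : Prop :=
  exists M : R, forall x, 0 <=v x -> x <=v e ->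
    (exists k : nat, x <=v `|g|v *+ k) -> vnorm NY (T x) <= M.

(* Gliding hump: unboundedness on every [g n] would produce a single vector
   [\sum_n 2^-n x_n] whose image dominates all the disjoint images of its pieces. *)
Lemma disjoint_bounded_below (e : V) (g : nat -> V) : ru_complete LX -> 0 <=v e ->
  (forall n m, n <> m -> vdisj LX (g n) (g m)) ->
  (forall n x r, 0 <=v x -> (exists k : nat, x <=v `|g n|v *+ k) ->
     vlhd LX r e -> vdisj LX r (g n) -> vdisj LY (T r) (T x)) ->
  exists n, bounded_below e (g n).
Proof.
move=> cpl e0 gD TD; apply: contrapT => /forallNP unb.
pose h n : R := 2^-1 ^+ n.
have h0 n : 0 < h n by rewrite exprn_gt0 // invr_gt0.
(* The threshold [n / h n] makes the weighted term [h n *: x n] have an image of norm above [n]. *)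
have /choice[x xP] n : exists x, [/\ 0 <=v x, x <=v e,
    (exists k : nat, x <=v `|g n|v *+ k) & n%:R / h n < vnorm NY (T x)].
  apply: contrapT => /forallNP H; apply: (unb n); exists (n%:R / h n) => x x0 xe xg.
  by rewrite leNgt; apply/negP => Tx; apply: (H x).
have x0 n : 0 <=v x n by case: (xP n).
have xe n : x n <=v e by case: (xP n).
have xg n m : n <> m -> vdisj LX (x n) (g m).
  move=> nm; have [_ _ [k xk] _] := xP n.
  apply: vdisj_le (vdisjMn k (gD _ _ nm)); rewrite vge0_abs //.
  by rewrite -scaler_nat vabsZ ger0_norm ?ler0n // scaler_nat.
pose z n := \sum_(i < n) h i *: x i.
have [s sP] : exists s, forall n, `|s - z n|v <=v (h n * 2) *: e.
  apply: ru_series => // n; rewrite /z big_ord_recr /= addrC addrK.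
  by rewrite vabsZ vge0_abs // ger0_norm ?(ltW (h0 n)) //; apply: vle_scale (ltW (h0 n)) (xe n).
have es n : vlhd LX (x n) e.
  by apply: vlhd_abs_le; rewrite !vge0_abs.
have se : vlhd LX s e.
  apply: (@vlhd_le _ _ _ 2); rewrite (vge0_abs e0).
  by have := sP 0%N; rewrite /z big_ord0 subr0 /h expr0 mul1r.
(* Without its [n]-th term, the series is a limit of partial sums disjoint from [g n]; taking
   [m > n] ensures that this term occurs in them. *)
have sg n : vdisj LX (s - h n *: x n) (g n).
  apply: (vdisj_lim e0) => eps eps0; have [N HN] := half_pow_small eps0.
  pose m := maxn N n.+1; have nm : (n < m)%N by apply: leq_maxr.
  exists (z m - h n *: x n).
    rewrite opprB addrA subrK; apply: vle_trans (sP m) _.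
    by apply: vscale_le => //; apply: HN; apply: leq_maxl.
  rewrite /z (bigD1 (Ordinal nm)) //= addrAC subrr add0r.
  apply: vdisj_sum => i /eqP ni; apply: vdisjZ; apply: xg => E.
  by apply: ni; apply: val_inj.
have big n : n%:R < vnorm NY (T s).
  have [_ _ xk Tx] := xP n.
  have D : vdisj LY (T (h n *: x n)) (T (s - h n *: x n)).
    rewrite linearZ; apply: vdisjZ; apply: vdisjC; apply: (TD n) => //.
    by apply: vlhdB => //; apply: vlhdZ.
  have := vnorm_disj NY D; rewrite -linearD [h n *: x n + _]addrC subrK.
  apply: lt_le_trans; rewrite linearZ vnormZ (ger0_norm (ltW (h0 n))) mulrC.
  by rewrite -ltr_pdivrMr.
have := archi_boundP (vnorm_ge0 NY (T s)); rewrite ltNge => /negP; apply.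
exact: ltW (big _).
Qed.
End UniformBoundedness.

(** * Inverses of disjointness preserving operators *)

Section Splitting.
Variables (R : realType) (V : lmodType R) (L : archVL V).
Local Notation "x <=v y" := (vle L x y) (at level 70).
Local Notation "`| x |v" := (vabs L x) (format "`| x |v").

Lemma vpos_lip (a b c : V) : 0 <=v c -> `|a - b|v <=v c ->
  `|vpos L a - vpos L b|v <=v c.
Proof.
have aux x y : 0 <=v c -> `|x - y|v <=v c -> vpos L x - vpos L y <=v c.
  move=> c0 xy; have H : vpos L x <=v vpos L y + c.
    apply: vpos_le; last exact: vadd_ge0 (vpos_ge0 _ _) c0.
    have xy' := vle_trans (vle_abs _ _) xy.
    by apply: (vle_lin (vle_addb (vle_pos L y) xy')); lmod R.
  by apply: (vle_lin H); lmod R.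
move=> c0 ab; apply: vabs_le; first exact: aux.
by rewrite opprB; apply: aux => //; rewrite vdistC.
Qed.

(* The value [s] is the supremum of the levels [t] at which [u] stays above [t v]
   wherever [u] does not vanish. *)
Lemma constant_ratio (u v : V) : 0 <=v u -> u <=v v ->
  (forall t : R, 0 <= t -> t <= 1 ->
     vpos L (u - t *: v) = 0 \/ vdisj L (vpos L (t *: v - u)) u) ->
  exists s : R, [/\ 0 <= s, u <=v s *: v & vdisj L (s *: v - u) u].
Proof.
move=> u0 uv H; have v0 := vle_trans u0 uv.
pose E (t : R) : Prop := [/\ 0 <= t, t <= 1 & vdisj L (vpos L (t *: v - u)) u].
have E0 : E 0.
  split=> //; rewrite vpos_le0; first exact: vdisj0.
  by apply: (vle_lin u0); lmod R.
have supE : has_sup E by split; [exists 0 | exists 1 => t []].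
have s0 : 0 <= sup E by apply: sup_upper_bound.
have us : u <=v sup E *: v.
  apply: (vle_eps v0) => eps eps0; rewrite -scalerDl.
  have [le1|gt1] := lerP (sup E + eps) 1; last first.
    by apply: vle_trans uv _; rewrite -[v in v <=v _]scale1r; apply: vscale_le (ltW gt1) v0.
  have se0 : 0 <= sup E + eps by rewrite addr_ge0 // ltW.
  have [/vpos_eq0 le0|D] := H _ se0 le1; first by apply: (vle_lin le0); lmod R.
  have : sup E + eps <= sup E by apply: sup_upper_bound.
  by rewrite gerDl leNgt eps0.
exists (sup E); split=> //; apply: (vdisj_lim v0) => eps eps0.
have [t [t0 t1 tD] st] := sup_adherent eps0 supE.
have ts : t <= sup E by apply: sup_upper_bound.
exists (vpos L (t *: v - u)) => //.
rewrite -[X in X - _](@vge0_pos _ _ L); last by apply: (vle_lin us); lmod R.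
apply: vpos_lip; first exact: vscale_ge0 (ltW eps0) v0.
rewrite opprB addrA subrK -scalerBl vabsZ (vge0_abs v0).
by apply: vscale_le => //; rewrite ger0_norm ?subr_ge0 // lerBlDr -lerBlDl ltW.
Qed.

(** One half of each split is kept as a term and the other is split again, so later terms lie in the
    discarded half. The map [f] allows the split objects to carry more data than the vectors
    compared. *)
Lemma splitting_sequence (Z : Type) (P : Z -> Prop) (f : Z -> V) (c0 : Z) : P c0 ->
  (forall c, P c -> exists a b, [/\ P a, P b, `|f a|v <=v `|f c|v,
     `|f b|v <=v `|f c|v & vdisj L (f a) (f b)]) ->
  exists g : nat -> Z, (forall n, P (g n)) /\
    (forall n m, n <> m -> vdisj L (f (g n)) (f (g m))).
Proof.
move=> Pc0 split.
have /choice[h hP] (c : {c | P c}) : exists ab : {c | P c} * {c | P c},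
    [/\ `|f (sval ab.1)|v <=v `|f (sval c)|v, `|f (sval ab.2)|v <=v `|f (sval c)|v
      & vdisj L (f (sval ab.1)) (f (sval ab.2))].
  have [a [b [Pa Pb ac bc ab]]] := split _ (svalP c).
  by exists (exist _ a Pa, exist _ b Pb).
pose c n := iter n (fun c => (h c).2) (exist _ c0 Pc0).
pose g n := (h (c n)).1.
have cle n k : `|f (sval (c (n + k)%N))|v <=v `|f (sval (c n))|v.
  elim: k => [|k IHk]; first by rewrite addn0; apply: vle_refl.
  by rewrite addnS; apply: vle_trans IHk; case: (hP (c (n + k)%N)).
have glt n m : (n < m)%N -> vdisj L (f (sval (g n))) (f (sval (g m))).
  move=> nm; have [_ _ D] := hP (c n); apply: vdisj_le2 D; first exact: vle_refl.
  have [gm _ _] := hP (c m); apply: vle_trans gm _.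
  by rewrite -(subnKC nm); apply: cle n.+1 _.
exists (fun n => sval (g n)); split=> [n|n m /eqP]; first exact: svalP.
by rewrite neq_ltn => /orP[/glt|/glt/vdisjC].
Qed.
End Splitting.

Section BoundedDisjointnessPreserving.
Variables (R : realType) (V W : lmodType R) (LX : archVL V) (LY : archVL W).
Variables (NY : vlnorm LY) (T : {linear V -> W}).
Hypothesis dpT : disj_preserving LX LY T.
Local Notation "x <=v y" := (vle LX x y) (at level 70).
Local Notation "x <=w y" := (vle LY x y) (at level 70).
Local Notation "`| x |v" := (vabs LX x) (format "`| x |v").
Local Notation "`| x |w" := (vabs LY x) (format "`| x |w").
Local Notation pos := (vpos LX).

(** The images of [a - c] and [b - c] have meet zero, and passing from them to [T a] and [T b] costs
    at most the modulus of [T c]. *)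
Lemma dp_inf_le (a b c : V) : vdisj LX (a - c) (b - c) ->
  vinf LY `|T a|w `|T b|w <=w `|T c|w.
Proof.
move=> /dpT; rewrite !linearB => D.
have le1 x : `|T x|w <=w `|T x - T c|w + `|T c|w.
  by rewrite -[T x in X in X <=w _](subrK (T c)); apply: vabsD.
have i0 := vinf_ge0 (vabs_ge0 LY (T a)) (vabs_ge0 LY (T b)).
have H : vinf LY `|T a|w `|T b|w - `|T c|w <=w vinf LY `|T a - T c|w `|T b - T c|w.
  apply: vinf_greatest.
    by apply: (vle_lin (vle_addb (le1 a) (vinf_lel LY `|T a|w `|T b|w))); lmod R.
  by apply: (vle_lin (vle_addb (le1 b) (vinf_ler LY `|T a|w `|T b|w))); lmod R.
by rewrite D in H; apply: (vle_lin H); lmod R.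
Qed.

(* Cut [k] along the levels [i/n a]: the layer [z i] lives where
   [i/n a < k < (i+1)/n a], the layers are disjoint, and their sum [z] is at most
   [a/n].  Away from [T a], the modulus of [T k] can only pass from
   [T (k - i/n a)^+] (everything at [i = 0], nothing at [i = n]) to
   [T (k - i/n a)^-] through [T z]. *)
Lemma dp_layers (k a : V) (w : W) (n : nat) : 0 <=v k -> k <=v a -> (0 < n)%N ->
  0 <=w w -> w <=w `|T k|w -> vdisj LY w (T a) ->
  exists z, [/\ 0 <=v z, z <=v n%:R^-1 *: a, z <=v k & w <=w `|T z|w].
Proof.
move=> k0 ka n0 w0 wk wa; have a0 := vle_trans k0 ka.
have nR : n%:R != 0 :> R by rewrite pnatr_eq0 -lt0n.
pose t i : R := i%:R / n%:R.
have t0 i : 0 <= t i by rewrite divr_ge0 // ler0n.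
pose F i := pos (k - t i *: a); pose G i := pos (t i *: a - k).
have Fmono i j : (i <= j)%N -> F j <=v F i.
  move=> ij; apply: vpos_mono; have tij : t i <= t j.
    by rewrite ler_pM2r ?invr_gt0 ?ltr0n // ler_nat.
  by apply: (vle_lin (vscale_le tij a0)); lmod R.
have Gmono i j : (i <= j)%N -> G i <=v G j.
  move=> ij; apply: vpos_mono; have tij : t i <= t j.
    by rewrite ler_pM2r ?invr_gt0 ?ltr0n // ler_nat.
  by apply: (vle_lin (vscale_le tij a0)); lmod R.
have FG i : vdisj LX (F i) (G i) by have := vpos_disj LX (k - t i *: a); rewrite opprB.
pose zi i := vinf LX (F i) (G i.+1).
have F0 i : 0 <=v F i by apply: vpos_ge0.
have G0 i : 0 <=v G i by apply: vpos_ge0.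
have z0 i : 0 <=v zi i by apply: vinf_ge0.
have an0 : 0 <=v n%:R^-1 *: a by apply: vscale_ge0 a0; rewrite invr_ge0 ler0n.
have zn i : zi i <=v n%:R^-1 *: a.
  have := vpos_inf_le (k - t i *: a) an0; congr (_ <=v _).
  congr (vinf _ _ (vpos _ _)); rewrite /t -(addn1 i) natrD mulrDl mul1r; lmod R.
have zk i : zi i <=v k.
  apply: vle_trans (vinf_lel _ _ _) _; apply: vpos_le => //.
  by apply: (vle_lin (vscale_ge0 (t0 i) a0)); lmod R.
have zlt i j : (i < j)%N -> vdisj LX (zi i) (zi j).
  move=> ij; apply: vdisj_le2 (vdisjC (FG j)); rewrite !vge0_abs //.
    exact: vle_trans (vinf_ler _ _ _) (Gmono _ _ ij).
  exact: vinf_lel.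
have zD i j : i <> j -> vdisj LX (zi i) (zi j).
  by move=> /eqP; rewrite neq_ltn => /orP[/zlt|/zlt/vdisjC].
pose z := \sum_(i < n) zi i.
have zsum (b : V) m : (forall i, zi i <=v b) -> 0 <=v b ->
    0 <=v \sum_(i < m) zi i /\ \sum_(i < m) zi i <=v b.
  move=> zb b0; elim: m => [|m [IH0 IHb]]; first by rewrite big_ord0; split=> //; apply: vle_refl.
  rewrite big_ord_recr /=; split; first exact: vadd_ge0.
  apply: vdisj_lub => //; apply: vdisj_sum => i _; apply: zD => E.
  by have := ltn_ord i; rewrite E ltnn.
exists z; have [zz0 zzn] := zsum _ n zn an0; have [_ zzk] := zsum _ n zk k0; split=> //.
have Tz i : (i < n)%N -> `|T (zi i)|w <=w `|T z|w.
  move=> lti; rewrite /z (bigD1 (Ordinal lti)) //= linearD; apply: vdisj_le_sum.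
  apply: dpT; apply: vdisjC; apply: vdisj_sum => j /eqP ji; apply: zD => E.
  by apply: ji; apply: val_inj.
have inf0 x y : 0 <=w vinf LY `|x|w `|y|w by apply: vinf_ge0; apply: vabs_ge0.
(* Descends through the levels: [F n] is zero, while [F 0] is [k], whose image dominates [w]. *)
suff H i : (i <= n)%N -> vinf LY w `|T (F (n - i)%N)|w <=w `|T z|w.
  have := H n (leqnn n); rewrite subnn; apply: vle_trans.
  apply: vinf_greatest; first exact: vle_refl.
  by rewrite /F /t mul0r scale0r subr0 vge0_pos.
elim: i => [_|i IHi lti].
  rewrite subn0 /F /t mulfV // scale1r vpos_le0 ?linear0 ?vabs0.
    by apply: vle_trans (vinf_ler _ _ _) (vabs_ge0 _ _).
  by apply: (vle_lin ka); lmod R.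
have := IHi (ltnW lti); have ltj : (n - i.+1 < n)%N by rewrite ltn_subrL.
have -> : (n - i = (n - i.+1).+1)%N by rewrite subnSK.
move: (n - i.+1)%N ltj => j ltj {}IHi.
set q := vinf LY w `|T (F j)|w.
have q0 : 0 <=w q by apply: vinf_ge0 => //; apply: vabs_ge0.
(* Cutting [k] at level [j.+1] leaves a multiple of [T a], which [w] does not see. *)
have E : T k = T (F j.+1) - T (G j.+1) + t j.+1 *: T a.
  rewrite -linearB -linearZ -linearD; congr (T _).
  have := vpos_neg LX (k - t j.+1 *: a); rewrite opprB => {1}<-.
  by rewrite subrK.
have DT := dpT (FG j.+1).
have q1 : q <=w `|T (F j.+1)|w + `|T (G j.+1)|w.
  apply: (@vle_disj _ _ _ _ _ `|t j.+1 *: T a|w) => //.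
  - by apply: vadd_ge0; apply: vabs_ge0.
  - exact: vabs_ge0.
  - apply: vle_trans (vinf_lel _ _ _) _; apply: vle_trans wk _; rewrite E.
    apply: vle_trans (vabsD _ _ _) _; apply: vle_add; exact: vabsB.
  - apply: vdisjC; apply/vdisj_absl; apply: vdisjZ; apply: vdisjC.
    by apply: vdisj_le wa; rewrite !vge0_abs //; apply: vinf_lel.
have qF : vinf LY q `|T (F j.+1)|w <=w `|T z|w.
  apply: vle_trans IHi; apply: vinf_greatest; last exact: vinf_ler.
  by apply: vle_trans (vinf_lel _ _ _) (vinf_lel _ _ _).
(* The layer [zi j] is the meet of [F j] and [G j.+1], so [dp_inf_le] applies with it as [c]. *)
have qG : vinf LY q `|T (G j.+1)|w <=w `|T z|w.
  apply: vle_trans (Tz _ ltj); apply: vle_trans (dp_inf_le (vinf_sub_disj _ _ _)).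
  apply: vinf_greatest; last exact: vinf_ler.
  by apply: vle_trans (vinf_lel _ _ _) (vinf_ler _ _ _).
have H := vinf_addr q0 (vabs_ge0 LY (T (F j.+1))) (vabs_ge0 LY (T (G j.+1))).
apply: (@vle_trans _ _ LY) (vle_trans H _); first exact: vinf_greatest (vle_refl _ _) q1.
have i1 : 0 <=w vinf LY q `|T (F j.+1)|w by apply: vinf_ge0 => //; apply: vabs_ge0.
have i2 : 0 <=w vinf LY q `|T (G j.+1)|w by apply: vinf_ge0 => //; apply: vabs_ge0.
apply: vdisj_lub => //.
apply: vdisj_le2 DT; rewrite vge0_abs //; exact: vinf_ler.
Qed.

(** The meet [p] of the moduli of [w] and [T k] is dominated by the image of a layer [z] with [n z]
    below [a]. Hence [n] times the norm of [p] is at most [M] for every [n]. *)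
Lemma dp_bounded_lhd (k a : V) (w : W) : 0 <=v k -> k <=v a ->
  bounded_below LX NY T a k -> vdisj LY w (T a) -> vdisj LY w (T k).
Proof.
move=> k0 ka [M bM] wa; have a0 := vle_trans k0 ka.
set p := vinf LY `|w|w `|T k|w; apply: (vnorm_arch_eq0 (N := NY) (C := M)) => n.
have p0 : 0 <=w p by apply: vinf_ge0; apply: vabs_ge0.
have M0 : 0 <= M.
  have := bM 0 (vle_refl _ _) a0; rewrite linear0 vnorm0; apply; exists 0%N.
  by rewrite mulr0n; apply: vle_refl.
have [->|n0] := posnP n; first by rewrite mul0r.
have pk : p <=w `|T k|w by apply: vinf_ler.
have pa : vdisj LY p (T a).
  by apply: vdisj_le wa; rewrite (vge0_abs p0); apply: vinf_lel.
have [z [z0 za zk pz]] := dp_layers k0 ka n0 p0 pk pa.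
have nz : 0 <=v n%:R *: z by apply: vscale_ge0 => //; apply: ler0n.
have le1 : n%:R *: z <=v a.
  have := vle_scale (ler0n R n) za.
  by rewrite scalerA mulfV ?scale1r // pnatr_eq0 -lt0n.
have := bM _ nz le1; rewrite linearZ vnormZ normr_nat => H.
apply: le_trans (H _); last first.
  by exists n; rewrite -scaler_nat (vge0_abs k0); apply: vle_scale (ler0n R n) zk.
apply: ler_wpM2l; first exact: ler0n.
by apply: vnorm_lattice; rewrite (vge0_abs p0).
Qed.

(** The images of the two parts of [x] are disjoint, so the modulus of each is below that of
    [T x]. *)
Lemma dp_abs_disj (a b : V) : vdisj LY (T a) (T b) -> vdisj LY (T `|a|v) (T `|b|v).
Proof.
have aux x w : vdisj LY (T x) w -> vdisj LY (T `|x|v) w.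
  have D := dpT (vpos_disj LX x).
  have := vdisj_absB D; rewrite -linearB -vpos_neg => E.
  move=> xw; rewrite vabs_pos_neg linearD.
  apply: vdisjD; apply: vdisj_le xw; rewrite E -[X in X <=w _]addr0.
    by apply: vle_addb (vle_refl _ _) (vabs_ge0 _ _).
  by rewrite addrC; apply: vle_addb (vabs_ge0 _ _) (vle_refl _ _).
by move=> /aux /vdisjC /aux /vdisjC.
Qed.

(** The case where the splitting stops: by [constant_ratio], the positive vectors in the ideal of an
    indivisible [g] are multiples of [g], and [e] bounds their coefficients. *)
Lemma atom_bounded_below (e g : V) : 0 <=v e -> 0 <=v g -> g <> 0 ->
  (forall x y, 0 <=v x -> 0 <=v y -> x <=v g -> y <=v g -> vdisj LX x y -> x = 0 \/ y = 0) ->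
  bounded_below LX NY T e g.
Proof.
move=> e0 g0 gN0 atom.
have atom2 x y k : 0 <=v x -> 0 <=v y -> x <=v g *+ k -> vdisj LX x y -> x = 0 \/ vdisj LX y g.
  move=> x0 y0 xk xy.
  have [|||||xg|yg] := atom (vinf LX x g) (vinf LX y g).
  - exact: vinf_ge0.
  - exact: vinf_ge0.
  - exact: vinf_ler.
  - exact: vinf_ler.
  - by apply: vdisj_le2 xy; rewrite !vge0_abs //; do ?[exact: vinf_lel|exact: vinf_ge0].
  - left; apply: vdisjxx; apply: vdisjC.
    have xg' : vdisj LX x g by rewrite /vdisj !vge0_abs.
    apply: vdisj_le (vdisjMn k (vdisjC xg')); rewrite !vge0_abs //.
    exact: vle_trans xk.
  - by right; rewrite /vdisj !vge0_abs.
have mult x k : 0 <=v x -> x <=v g *+ k -> exists2 s : R, 0 <= s & x = s *: g.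
  move=> x0 xk; have gk0 := vle_trans x0 xk.
  have [t t0 t1|s [s0 xs D]] := constant_ratio x0 xk.
    have [|||||] := atom2 (vpos LX (x - t *: (g *+ k))) (vpos LX (t *: (g *+ k) - x)) k.
    - exact: vpos_ge0.
    - exact: vpos_ge0.
    - apply: vpos_le => //; apply: vle_trans xk; apply: (vle_lin (vscale_ge0 t0 gk0)); lmod R.
    - by have := vpos_disj LX (x - t *: (g *+ k)); rewrite opprB.
    - by left.
    - move=> D; right; apply: vdisjC; apply: vdisj_le (vdisjMn k (vdisjC D)).
      by rewrite !vge0_abs.
  have sx0 : 0 <=v s *: (g *+ k) - x by apply: (vle_lin xs); lmod R.
  have [||||->|gD] := atom2 x (s *: (g *+ k) - x) k => //.
    exact: vdisjC.
    by exists 0; rewrite ?scale0r.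
  exists (s * k%:R); first by rewrite mulr_ge0 // ler0n.
  rewrite -scalerA scaler_nat; apply/eqP; rewrite eq_sym -subr_eq0; apply/eqP.
  apply: vdisjxx; apply: vdisjB; last exact: vdisjC D.
  by apply: vdisjZ; apply: vdisjMn; apply: vdisjC gD.
have [N HN] : exists N : nat, ~ (g *+ N <=v e).
  by apply: contrapT => /forallNP H; apply: gN0; apply: (varchimedean g0) => n; apply: contrapT; apply: H.
exists (N%:R * vnorm NY (T g)) => x x0 xe [k]; rewrite (vge0_abs g0) => xk.
have [s s0 xE] := mult _ _ x0 xk; rewrite xE linearZ vnormZ ger0_norm //.
apply: ler_wpM2r; first exact: vnorm_ge0.
rewrite leNgt; apply/negP => Ns; apply: HN; rewrite -scaler_nat; apply: vle_trans xe.
by rewrite xE; apply: vscale_le => //; apply: ltW.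
Qed.

(** Below a nonzero meet [h] there is either an indivisible vector or an infinite disjoint sequence,
    and both give a nonzero [g] where [T] is bounded. Then [T g] is disjoint first from the image of
    [|b|], then from itself. *)
Lemma dp_inverse_disj : ru_complete LX -> injective T -> forall a b,
  vdisj LY (T a) (T b) -> vdisj LX a b.
Proof.
move=> cpl injT a b /dp_abs_disj D; apply: contrapT => nab.
set h := vinf LX `|a|v `|b|v; have hN0 : h <> 0 by [].
have h0 : 0 <=v h by apply: vinf_ge0; apply: vabs_ge0.
(* Dominating both moduli lets a single bound serve for [a] and for [b]. *)
pose e := `|a|v + `|b|v; have e0 : 0 <=v e by apply: vadd_ge0; apply: vabs_ge0.
have he : h <=v e.
  by apply: (vle_lin (vle_addb (vinf_lel LX `|a|v `|b|v) (vabs_ge0 LX b))); rewrite /e; lmod R.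
have nTD n x r (g : V) : 0 <=v x -> x <=v `|g|v *+ n -> vdisj LX r g -> vdisj LY (T r) (T x).
  move=> x0 xg rg; apply: dpT; apply: vdisjC.
  apply: vdisj_le (vdisjMn n (vdisjC rg)); rewrite (vge0_abs x0).
  by rewrite -scaler_nat vabsZ normr_nat scaler_nat.
suff [g [g0 gh gN0 gb]] : exists g, [/\ 0 <=v g, g <=v h, g <> 0 & bounded_below LX NY T e g].
  have sub c : `|c|v <=v e -> g <=v `|c|v -> bounded_below LX NY T `|c|v g.
    by move=> ce gc; case: gb => M bM; exists M => x x0 xc; apply: bM => //; apply: vle_trans ce.
  have ga : g <=v `|a|v := vle_trans gh (vinf_lel _ _ _).
  have gb' : g <=v `|b|v := vle_trans gh (vinf_ler _ _ _).
  have ba : bounded_below LX NY T `|a|v g.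
    by apply: sub => //; rewrite /e; apply: (vle_lin (vabs_ge0 LX b)); lmod R.
  have bb : bounded_below LX NY T `|b|v g.
    by apply: sub => //; rewrite /e; apply: (vle_lin (vabs_ge0 LX a)); lmod R.
  have D1 := dp_bounded_lhd g0 ga ba (vdisjC D).
  have := dp_bounded_lhd g0 gb' bb (vdisjC D1) => /vdisjxx Tg0.
  by apply: gN0; apply: injT; rewrite linear0.
apply: contrapT => /forallNP bad.
pose P g := [/\ 0 <=v g, g <=v h & g <> 0].
have split g : P g -> exists x y, [/\ P x, P y, `|x|v <=v `|g|v, `|y|v <=v `|g|v & vdisj LX x y].
  move=> [g0 gh gN0]; apply: contrapT => Nsplit; apply: (bad g); split=> //.
  apply: atom_bounded_below => // x y x0 y0 xg yg xy.
  have [->|/eqP xN0] := eqVneq x 0; first by left.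
  have [->|/eqP yN0] := eqVneq y 0; first by right.
  case: Nsplit; exists x, y; split=> //; rewrite ?vge0_abs //; split=> //; exact: vle_trans gh.
have [|g [gP gD]] := @splitting_sequence _ _ LX _ P id h _ split.
  by split=> //; apply: vle_refl.
have [|n] := disjoint_bounded_below NY (T := T) cpl e0 gD.
  by move=> n x r x0 [k xk] _ rg; apply: nTD xk rg.
by have [gn0 gnh gnN0] := gP n; move=> bn; apply: (bad (g n)).
Qed.
End BoundedDisjointnessPreserving.

(** * Operators satisfying condition (beta) *)

Section ConditionBeta.
Variables (R : realType) (V W : lmodType R) (LX : archVL V) (LY : archVL W).
Variables (T : {linear V -> W}) (S : {linear W -> V}).
Hypotheses (TK : cancel T S) (SK : cancel S T).
Local Notation "x <=v y" := (vle LX x y) (at level 70).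
Local Notation "x <=w y" := (vle LY x y) (at level 70).
Local Notation "`| x |v" := (vabs LX x) (format "`| x |v").
Local Notation "`| x |w" := (vabs LY x) (format "`| x |w").
Local Notation pos := (vpos LY).

Lemma dp_beta : disj_preserving LX LY T -> disj_preserving LY LX S ->
  cond_beta LX LY T.
Proof.
move=> dT dS a b /vlhdP ab; apply/vlhdP => w wb.
by rewrite -(SK w); apply/dT/ab; rewrite -(TK b); apply: dS.
Qed.

Hypothesis beta : cond_beta LX LY T.

Lemma beta_lhd (x : V) (y : W) : vlhd LX x (S y) -> vlhd LY (T x) y.
Proof. by move/beta; rewrite SK. Qed.

Lemma beta_inverse_dp : disj_preserving LY LX S.
Proof.
move=> u v uv; rewrite /vdisj; set c := vinf LX _ _.
have c0 : 0 <=v c by apply: vinf_ge0; apply: vabs_ge0.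
have cu : vlhd LY (T c) u.
  by apply: beta_lhd; apply: vlhd_abs_le; rewrite (vge0_abs c0); apply: vinf_lel.
have cv : vlhd LY (T c) v.
  by apply: beta_lhd; apply: vlhd_abs_le; rewrite (vge0_abs c0); apply: vinf_ler.
have /vdisjxx Tc := vlhd_disj cu cv uv.
by rewrite -[LHS]TK Tc linear0.
Qed.

(* The components of [T^-1 (u - q)] given by the positive and negative parts of
   [u - q] split both its part along [T^-1 u] and its part along [T^-1 q]. *)
Lemma beta_split (u v q : W) (c : R) : 0 < c -> vdisj LX (S u) (S v) -> 0 <=v S v ->
  vdisj LX (S u) (S q) -> c *: S v <=v S q ->
  exists u1 u2 v1 v2, [/\ u = u1 + u2, v = v1 + v2,
    vlhd LY u1 (pos (u - q)) /\ vlhd LY v1 (pos (u - q)) &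
    vlhd LY u2 (pos (q - u)) /\ vlhd LY v2 (pos (q - u))].
Proof.
move=> c0 uv v0 uq vq; set A := pos (u - q); set B := pos (q - u).
have AB : u - q = A - B by have := vpos_neg LY (u - q); rewrite opprB.
have D : vdisj LX (S A) (S B).
  by apply: beta_inverse_dp; have := vpos_disj LY (u - q); rewrite opprB.
(* Both sides are the modulus of [S (u - q)], written through two disjoint decompositions. *)
have E : `|S u|v + `|S q|v = `|S A|v + `|S B|v.
  by rewrite -(vdisj_absB uq) -(vdisj_absB D) -!linearB AB.
have D' : vdisj LX `|S A|v `|S B|v by rewrite /vdisj !vabs_id.
have ub : `|S u|v <=v `|S A|v + `|S B|v.
  by rewrite -E; apply: (vle_lin (vabs_ge0 LX (S q))); lmod R.
have vb : `|S v|v <=v c^-1 *: `|S A|v + c^-1 *: `|S B|v.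
  rewrite -scalerDr -E; apply: vle_scale_inv => //; rewrite (vge0_abs v0).
  apply: vle_trans vq _; apply: vle_trans (vle_abs LX _) _.
  by apply: (vle_lin (vabs_ge0 LX (S u))); lmod R.
have ic0 : 0 <= c^-1 by rewrite invr_ge0 ltW.
have [x1 [x2 [xE x1A x2B]]] := vdisj_decomp (vabs_ge0 _ _) (vabs_ge0 _ _) D' ub.
have [|y1 [y2 [yE y1A y2B]]] := vdisj_decomp (vscale_ge0 ic0 (vabs_ge0 _ _))
    (vscale_ge0 ic0 (vabs_ge0 _ _)) _ vb.
  by apply: vdisjZ; apply: vdisjC; apply: vdisjZ; apply: vdisjC.
exists (T x1), (T x2), (T y1), (T y2); split.
- by rewrite -linearD -xE SK.
- by rewrite -linearD -yE SK.
- by split; apply: beta_lhd; [apply: vlhd_abs_le | apply: vlhd_le y1A].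
- by split; apply: beta_lhd; [apply: vlhd_abs_le | apply: vlhd_le y2B].
Qed.

(** Applies [beta_split] with [q = t *: v], so that [u1, v1] live where [u] exceeds [t v] and
    [u2, v2] where it falls short. *)
Lemma beta_split_level (u v : W) (t : R) : 0 < t ->
  0 <=w u -> 0 <=w v -> vdisj LX (S u) (S v) -> 0 <=v S v ->
  exists u1 u2 v1 v2,
    [/\ [/\ u = u1 + u2, v = v1 + v2, 0 <=w u1 & 0 <=w u2],
        [/\ 0 <=w v1, 0 <=w v2, 0 <=v S v1 & 0 <=v S v2],
        [/\ vdisj LY u1 u2, vdisj LY u1 v2, vdisj LY v1 u2 & vdisj LY v1 v2] &
        pos (u - t *: v) = u1 - t *: v1 /\ pos (t *: v - u) = t *: v2 - u2].
Proof.
move=> t0 u0 v0 uv Sv0.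
have uq : vdisj LX (S u) (S (t *: v)).
  by rewrite linearZ; apply: vdisjC; apply: vdisjZ; apply: vdisjC.
have vq : t *: S v <=v S (t *: v) by rewrite linearZ; apply: vle_refl.
have [u1 [u2 [v1 [v2 [uE vE [u1A v1A] [u2B v2B]]]]]] := beta_split t0 uv Sv0 uq vq.
have AB : vdisj LY (pos (u - t *: v)) (pos (t *: v - u)).
  by have := vpos_disj LY (u - t *: v); rewrite opprB.
have D x y : vlhd LY x (pos (u - t *: v)) -> vlhd LY y (pos (t *: v - u)) -> vdisj LY x y.
  by move=> xA yB; apply: vlhd_disj xA yB AB.
have [u12 u1v2 v1u2 v12] := And4 (D _ _ u1A u2B) (D _ _ u1A v2B) (D _ _ v1A u2B) (D _ _ v1A v2B).
have Sv12 := beta_inverse_dp v12.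
have E : pos (u - t *: v) - (u1 - t *: v1) = pos (t *: v - u) - (t *: v2 - u2).
  have := vpos_neg LY (u - t *: v); rewrite opprB {1}uE {1}vE => H.
  have H0 : pos (u - t *: v) - pos (t *: v - u) - (u1 + u2 - t *: (v1 + v2)) = 0.
    by rewrite H subrr.
  by apply/eqP; rewrite -subr_eq0; apply/eqP; rewrite -[RHS]H0; lmod R.
(* By [E] this vector lies in the bands of two disjoint vectors, hence is zero. *)
have E0 : pos (u - t *: v) - (u1 - t *: v1) = 0.
  apply: vdisjxx; rewrite {2}E; apply: D.
    by do ?apply: vlhdB => //; apply: vlhdZ.
  by do ?apply: vlhdB => //; apply: vlhdZ.
exists u1, u2, v1, v2; split=> //.
- split=> //; first by apply: vdisj_ge0 u12 _; rewrite -uE.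
  by apply: vdisj_ge0 (vdisjC u12) _; rewrite addrC -uE.
- split.
  + by apply: vdisj_ge0 v12 _; rewrite -vE.
  + by apply: vdisj_ge0 (vdisjC v12) _; rewrite addrC -vE.
  + by apply: vdisj_ge0 Sv12 _; rewrite -linearD -vE.
  + by apply: vdisj_ge0 (vdisjC Sv12) _; rewrite -linearD addrC -vE.
- split; apply/eqP; rewrite -subr_eq0; first by rewrite E0.
  by rewrite -E E0.
Qed.

(** One binary digit: [t v] is added to [w] only on the component [v1] of [v] where [u - w] exceeds
    it, which halves the error bound. *)
Lemma beta_binary_step (u v w : W) (t : R) : 0 < t ->
  vdisj LX (S u) (S v) -> 0 <=v S v ->
  0 <=w u - w -> u - w <=w (t *+ 2) *: v -> 0 <=v S w -> vdisj LX (S u) (S w) ->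
  exists w', [/\ 0 <=w u - w', u - w' <=w t *: v, 0 <=v S w', vdisj LX (S u) (S w') &
                 `|S w' - S w|v <=v t *: S v].
Proof.
move=> t0 uv Sv0 uw0 uwt Sw0 uSw; pose q := w + t *: v.
have uq : vdisj LX (S u) (S q).
  rewrite linearD linearZ; apply: vdisjC; apply: vdisjD; first exact: vdisjC.
  by apply: vdisjZ; apply: vdisjC.
have vq : t *: S v <=v S q by rewrite linearD linearZZ; apply: (vle_lin Sw0); lmod R.
have [u1 [u2 [v1 [v2 [uE vE [u1A v1A] [u2B v2B]]]]]] := beta_split t0 uv Sv0 uq vq.
set A := pos (u - q) in u1A v1A *; set B := pos (q - u) in u2B v2B *.
have AB : vdisj LY A B by have := vpos_disj LY (u - q); rewrite opprB.
have ABE : u - w = A - B + t *: v1 + t *: v2.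
  have := vpos_neg LY (u - q); rewrite opprB -/A -/B /q {1}vE => <-; lmod R.
have [A0 B0] : 0 <=w A /\ 0 <=w B by split; apply: vpos_ge0.
have v12 := vlhd_disj v1A v2B AB; have Sv12 := beta_inverse_dp v12.
have Sv10 : 0 <=v S v1 by apply: vdisj_ge0 Sv12 _; rewrite -linearD -vE.
have Sv20 : 0 <=v S v2 by apply: vdisj_ge0 (vdisjC Sv12) _; rewrite -linearD addrC -vE.
have Sv1v : S v1 <=v S v by rewrite vE linearD; apply: (vle_lin Sv20); lmod R.
(* The bounds [0 <= u - w] and [u - w <= 2 t v] are read on separate components: the first gives
   [Q0], the second [P0]. *)
have Q0 : 0 <=w t *: v2 - B.
  apply: (@vdisj_ge0 _ _ _ _ (A + t *: v1)); last first.
    by move: uw0; rewrite ABE; congr (_ <=w _); lmod R.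
  apply: vdisjC; apply: vlhd_disj AB; first by apply: vlhdD => //; apply: vlhdZ.
  by apply: vlhdB => //; apply: vlhdZ.
have P0 : 0 <=w t *: v1 - A.
  apply: (@vdisj_ge0 _ _ _ _ (t *: v2 + B)); last first.
    by rewrite ABE vE in uwt; apply: (vle_lin uwt); lmod R.
  apply: vlhd_disj AB; first by apply: vlhdB => //; apply: vlhdZ.
  by apply: vlhdD => //; apply: vlhdZ.
exists (w + t *: v1); split.
- by rewrite opprD addrA ABE; apply: (vle_lin (vle_addb A0 Q0)); lmod R.
- by rewrite opprD addrA ABE {1}vE; apply: (vle_lin (vle_addb P0 B0)); lmod R.
- by rewrite linearD linearZ; apply: vadd_ge0 => //; apply: vscale_ge0 (ltW t0) _.
- rewrite linearD linearZ; apply: vdisjC; apply: vdisjD; first exact: vdisjC.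
  by apply: vdisjZ; apply: vdisj_le (vdisjC uv); rewrite !vge0_abs.
- rewrite -linearB addrC addKr linearZ vabsZ (gtr0_norm t0) (vge0_abs Sv10).
  exact: vle_scale (ltW t0) Sv1v.
Qed.

Variable NY : vlnorm LY.

Lemma bounded_below_abs (M c : R) (e x : V) : 0 <=v e -> 0 < c ->
  (forall x, 0 <=v x -> x <=v e -> vnorm NY (T x) <= M) ->
  `|x|v <=v c *: e -> vnorm NY (T x) <= c * (M *+ 2).
Proof.
move=> e0 c0 bM xe.
have bpos y : 0 <=v y -> y <=v c *: e -> vnorm NY (T y) <= c * M.
  move=> y0 ye; rewrite -ler_pdivrMl //.
  have ic0 : 0 <= c^-1 by rewrite invr_ge0 ltW.
  have := bM _ (vscale_ge0 ic0 y0); rewrite linearZ vnormZ (ger0_norm ic0); apply.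
  by have := vle_scale ic0 ye; rewrite scalerA mulVf ?scale1r // gt_eqF.
rewrite (vpos_neg LX x) linearB; apply: le_trans (vnormD _ _ _) _.
rewrite vnormN mulr2n mulrDr; apply: lerD; apply: bpos; do ?exact: vpos_ge0.
  exact: vle_trans (vpos_le_abs _ _) xe.
exact: vle_trans (vneg_le_abs _ _) xe.
Qed.

(* With [T] bounded, the binary expansion of [u] with respect to [v] produces [z] in
   the band of [T^-1 v] with [T z = u], although [T^-1 u] is disjoint from it. *)
Lemma beta_bounded_eq0 (u v : W) : ru_complete LX ->
  0 <=w u -> u <=w v -> vdisj LX (S u) (S v) -> 0 <=v S v ->
  bounded_below LX NY T (S v) (S v) -> u = 0.
Proof.
move=> cpl u0 le_uv uv Sv0 [M bM].
have {}bM x : 0 <=v x -> x <=v S v -> vnorm NY (T x) <= M.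
  by move=> x0 xv; apply: bM => //; exists 1%N; rewrite mulr1n (vge0_abs Sv0).
pose h n : R := 2^-1 ^+ n.
have h0 n : 0 < h n by rewrite exprn_gt0 // invr_gt0.
have hS n : h n = h n.+1 *+ 2 by rewrite /h exprS; move: (2^-1 ^+ n) => a; field.
pose Inv n w := [/\ 0 <=w u - w, u - w <=w h n *: v, 0 <=v S w & vdisj LX (S u) (S w)].
(* Choice needs a total function; off the invariant the value [0] is arbitrary. *)
have /choice[f fP] (p : nat * W) : exists w', Inv p.1 p.2 ->
    Inv p.1.+1 w' /\ `|S w' - S p.2|v <=v h p.1 *: S v.
  have [I|nI] := pselect (Inv p.1 p.2); last by exists 0.
  have [w0 wt Sw0 uw] := I; rewrite hS in wt.
  have [w' [w'0 w't Sw'0 uw' dw]] := beta_binary_step (h0 _) uv Sv0 w0 wt Sw0 uw.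
  exists w' => _; split=> //; apply: vle_trans dw _; apply: vscale_le => //.
  by rewrite (hS p.1) mulr2n lerDl ltW.
pose w n := nat_rect (fun=> W) 0 (fun n w => f (n, w)) n.
have wI n : Inv n (w n).
  elim: n => [|n IHn]; last by have [] := fP (n, w n) IHn.
  split; rewrite /= ?subr0 ?linear0 /h ?expr0 ?scale1r //; first exact: vle_refl.
  by apply: vdisjC; apply: vdisj0.
have [z zP] := ru_series (z := fun n => S (w n)) cpl Sv0 (fun n => proj2 (fP (n, w n) (wI n))).
have Tz : T z = u.
  apply/eqP; rewrite -subr_eq0; apply/eqP.
  (* In the constant, [2] is the geometric tail, [M *+ 2] accounts for both signs of [z - S (w n)],
     and the norm of [v] bounds the remainder [u - w n]. *)
  apply: (@vnorm_arch_eq0 _ _ _ NY _ (2 * (M *+ 2) + vnorm NY v)) => n.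
  have nh : n%:R * h n <= 1.
    rewrite /h exprVn ler_pdivrMr ?exprn_gt0 // mul1r -natrX ler_nat.
    exact: ltnW (ltn_expl _ _).
  have b1 : vnorm NY (T (z - S (w n))) <= h n * 2 * (M *+ 2).
    by apply: bounded_below_abs (zP n); rewrite // mulr_gt0.
  have b2 : vnorm NY (u - w n) <= h n * vnorm NY v.
    have [w0 wt _ _] := wI n; rewrite -[h n]gtr0_norm // -vnormZ.
    exact: vnorm_le.
  have M0 : 0 <= M by apply: le_trans (bM 0 (vle_refl _ _) Sv0); apply: vnorm_ge0.
  have C0 : 0 <= 2 * (M *+ 2) + vnorm NY v.
    by rewrite addr_ge0 ?vnorm_ge0 // mulr_ge0 // mulrn_wge0.
  apply: le_trans (_ : n%:R * (h n * (2 * (M *+ 2) + vnorm NY v)) <= _).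
    apply: ler_wpM2l; first exact: ler0n.
    rewrite (_ : T z - u = T (z - S (w n)) - (u - w n)); last by rewrite linearB SK; lmod R.
    by apply: le_trans (vnormD _ _ _) _; rewrite vnormN mulrDr mulrA; apply: lerD.
  by rewrite mulrA; apply: ler_piMl.
have zS : z = S u by rewrite -Tz TK.
(* Each [S (w n)] is disjoint from [S u], and their limit is [S u] itself. *)
have uu : vdisj LX (S u) (S u).
  apply: (vdisj_lim Sv0) => eps eps0; have [N HN] := half_pow_small eps0.
  exists (S (w N)); last by have [_ _ _ uw] := wI N; apply: vdisjC.
  by rewrite -zS; apply: vle_trans (zP N) _; apply: vscale_le => //; apply: HN.
by rewrite -(SK u) (vdisjxx uu) linear0.
Qed.

(** Removes the boundedness assumption of [beta_bounded_eq0]: a nonzero pair can always be split by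
    a level of its ratio, and the gliding hump makes [T] bounded on one of the resulting pieces. *)
Lemma beta_cell_eq0 (u v : W) : ru_complete LX ->
  0 <=w u -> u <=w v -> vdisj LX (S u) (S v) -> 0 <=v S v -> u = 0.
Proof.
move=> cpl u0 le_uv uv Sv0; apply: contrapT => uN0.
(* The last clause makes [c.2] a component of [v], which the disjointness premise of the gliding
   hump requires. *)
pose P (c : W * W) := [/\ [/\ 0 <=w c.1, c.1 <=w c.2 & c.1 <> 0],
  vdisj LX (S c.1) (S c.2), 0 <=v S c.2, S c.2 <=v S v & vdisj LY c.2 (v - c.2)].
have P0 : P (u, v).
  split=> //=; first exact: vle_refl.
  by rewrite subrr; apply: vdisjC; apply: vdisj0.
have split c : P c -> exists a b, [/\ P a, P b, `|S a.2|v <=v `|S c.2|v,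
    `|S b.2|v <=v `|S c.2|v & vdisj LX (S a.2) (S b.2)].
  case: c => a b [/= [a0 le_ab aN0] ab Sb0 Sbv bv]; apply: contrapT => Nsplit.
  have b0 := vle_trans a0 le_ab.
  (* A constant ratio is impossible: [S a] is a component of [S (a - s b)], so (beta) puts [a] in
     the band of [a - s b], although [D] makes them disjoint. *)
  have [t t0 t1|s [s0 abs D]] := constant_ratio a0 le_ab; last first.
    apply: aN0; apply: vdisjxx; have /beta/vlhdP : vlhd LX (S a) (S a - s *: S b).
      apply: vlhd_abs_le; apply: vdisj_le_sum; apply: vdisjC; apply: vdisjN.
      by apply: vdisjZ; apply: vdisjC.
    rewrite linearB linearZ !SK; apply; apply: vdisjC.
    by rewrite -opprB; apply: vdisjN.
  have [->|tN0] := eqVneq t 0.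
    right; rewrite scale0r sub0r vpos_le0; first exact: vdisj0.
    by apply: (vle_lin a0); lmod R.
  have {}t0 : 0 < t by rewrite lt_neqAle eq_sym tN0.
  have [a1 [a2 [b1 [b2 [[aE bE a10 a20] [b10 b20 Sb10 Sb20] [a12 a1b2 b1a2 b12] [A B]]]]]] :=
    beta_split_level t0 a0 b0 ab Sb0.
  have [a1E|/eqP a1N] := eqVneq a1 0.
    left; apply: (@vle_anti _ _ LY); last exact: vpos_ge0.
    by rewrite A a1E; apply: (vle_lin (vscale_ge0 (ltW t0) b10)); lmod R.
  have [a2E|/eqP a2N] := eqVneq a2 0.
    right; rewrite B a2E subr0 aE a2E addr0.
    by apply: vdisjZ; apply: vdisjC.
  have Sb12 := beta_inverse_dp b12; have Sa12 := beta_inverse_dp a12.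
  have SE1 : S b1 <=v S b by rewrite bE linearD; apply: (vle_lin Sb20); lmod R.
  have SE2 : S b2 <=v S b by rewrite bE linearD; apply: (vle_lin Sb10); lmod R.
  have le1 : b1 <=w b by rewrite bE; apply: (vle_lin b20); lmod R.
  have le2 : b2 <=w b by rewrite bE; apply: (vle_lin b10); lmod R.
  case: Nsplit; exists (a1, b1), (a2, b2); split=> /=; rewrite ?vge0_abs //.
  - split=> //=.
    + split=> //; apply: (@vle_disj _ _ _ _ _ b2) => //; rewrite -bE.
      by apply: vle_trans le_ab; rewrite aE; apply: (vle_lin a20); lmod R.
    + apply: vdisj_le2 ab; last by rewrite !vge0_abs.
      by rewrite aE linearD; apply: vdisj_le_sum.
    + exact: vle_trans Sbv.
    + rewrite (_ : v - b1 = (v - b) + b2); last by rewrite bE; lmod R.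
      apply: vdisjC; apply: vdisjD; last exact: vdisjC.
      by apply: vdisjC; apply: vdisj_le bv; rewrite !vge0_abs.
  - split=> //=.
    + split=> //; apply: (@vle_disj _ _ _ _ _ b1) => //; last exact: vdisjC.
      rewrite addrC -bE.
      by apply: vle_trans le_ab; rewrite aE; apply: (vle_lin a10); lmod R.
    + apply: vdisj_le2 ab; last by rewrite !vge0_abs.
      by rewrite aE linearD addrC; apply: vdisj_le_sum; apply: vdisjC.
    + exact: vle_trans Sbv.
    + rewrite (_ : v - b2 = (v - b) + b1); last by rewrite bE; lmod R.
      apply: vdisjC; apply: vdisjD => //.
      by apply: vdisjC; apply: vdisj_le bv; rewrite !vge0_abs.
have [g [gP gD]] := splitting_sequence P0 split.
have [|n [M bM]] := disjoint_bounded_below NY (T := T) cpl Sv0 gD.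
  move=> n x r x0 [k xk] rv rg; have [_ _ Sg0 _ gv] := gP n.
  have xg : vlhd LY (T x) (g n).2.
    by apply: beta_lhd; apply: (@vlhd_le _ _ _ k%:R); rewrite (vge0_abs x0) scaler_nat.
  (* A vector in the band of [S v] and disjoint from [S (g n).2] lies in the band of the other
     component of [S v]. *)
  suff /beta_lhd rvg : vlhd LX r (S (v - (g n).2)) by apply: vlhd_disj rvg xg (vdisjC gv).
  apply/vlhdP => y yd; rewrite /vdisj; set m := vinf LX _ _.
  have m0 : 0 <=v m by apply: vinf_ge0; apply: vabs_ge0.
  have my : vdisj LX m (S (v - (g n).2)).
    by apply: vdisj_le yd; rewrite (vge0_abs m0); apply: vinf_lel.
  have mr : `|m|v <=v `|r|v by rewrite (vge0_abs m0); apply: vinf_ler.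
  have mg := vdisj_le mr rg.
  have mv : vdisj LX m (S v).
    rewrite -[v](subrK (g n).2) linearD; apply: vdisjC.
    by apply: vdisjD; apply: vdisjC.
  have /vlhdP/(_ _ mv) := rv => mr'; apply: vdisjxx; apply: vdisjC.
  by apply: vdisj_le (vdisjC mr').
have [[g0 gle gN0] gD' Sg0 gSv _] := gP n.
apply: gN0; apply: beta_bounded_eq0 gD' Sg0 _ => //.
by exists M => x x0 xg; apply: bM => //; apply: vle_trans gSv.
Qed.

(** At level [n.+1], [beta_cell_eq0] kills [u2]. Hence [u] is disjoint from [v2], its meet with [v]
    is below [v1], and [n.+1] times [v1] is below [u]; the Archimedean axiom concludes. *)
Lemma beta_pos_disj (u v : W) : ru_complete LX ->
  0 <=w u -> 0 <=w v -> vdisj LX (S u) (S v) -> 0 <=v S v -> vdisj LY u v.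
Proof.
move=> cpl u0 v0 uv Sv0; rewrite /vdisj !vge0_abs //.
have i0 := vinf_ge0 u0 v0; apply: (varchimedean i0 (y := u)) => -[//|n].
have t0 : 0 < n.+1%:R :> R by rewrite ltr0n.
have [u1 [u2 [v1 [v2 [[uE vE u10 u20] [v10 v20 Sv10 Sv20] [u12 u1v2 _ v12] [A B]]]]]] :=
  beta_split_level t0 u0 v0 uv Sv0.
have u2E : u2 = 0.
  apply: (@beta_cell_eq0 u2 (n.+1%:R *: v2)) => //.
  - by have := vpos_ge0 LY (n.+1%:R *: v - u); rewrite B => H; apply: (vle_lin H); lmod R.
  - rewrite linearZ; apply: vdisjC; apply: vdisjZ; apply: vdisjC.
    have Su12 := beta_inverse_dp u12; have Sv12 := beta_inverse_dp v12.
    apply: vdisj_le2 uv.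
      by rewrite uE linearD addrC; apply: vdisj_le_sum; apply: vdisjC.
    by rewrite vE linearD addrC; apply: vdisj_le_sum; apply: vdisjC.
  - by rewrite linearZ; apply: vscale_ge0 (ltW t0) Sv20.
have u1E : u = u1 by rewrite uE u2E addr0.
have iv1 : vinf LY u v <=w v1.
  have := vinf_addr u0 v10 v20; rewrite -vE => /vle_trans; apply.
  rewrite {2}u1E; move: u1v2; rewrite /vdisj !vge0_abs // => ->; rewrite addr0.
  exact: vinf_ler.
rewrite -scaler_nat; apply: vle_trans (vle_scale (ltW t0) iv1) _.
have := vpos_ge0 LY (u - n.+1%:R *: v); rewrite A -u1E => H.
by apply: (vle_lin H); lmod R.
Qed.

End ConditionBeta.

(** * Condition (beta) implies disjointness preservation *)

Section BetaDisjointnessPreserving.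
Variables (R : realType) (V W : lmodType R) (LX : archVL V) (LY : archVL W).
Variables (T : {linear V -> W}) (S : {linear W -> V}).
Hypotheses (TK : cancel T S) (SK : cancel S T).
Local Notation "x <=v y" := (vle LX x y) (at level 70).

Lemma beta_dp : ru_complete LX -> vlnorm LY -> cond_beta LX LY T ->
  disj_preserving LX LY T.
Proof.
move=> cpl NY beta x y xy.
have dS := beta_inverse_dp TK SK beta.
have lhd_abs z : vlhd LY (T z) (T (vabs LX z)).
  by apply: beta; apply: vlhd_abs_le; rewrite vabs_id; apply: vle_refl.
apply: vlhd_disj (lhd_abs x) (lhd_abs y) _.
set u := T (vabs LX x); set v := T (vabs LX y).
have Spart z : vdisj LX (S (vpos LY (T z))) (- S (vpos LY (- T z))) /\
    z = S (vpos LY (T z)) + - S (vpos LY (- T z)).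
  split; last by rewrite -linearB -vpos_neg TK.
  by apply: vdisjC; apply: vdisjN; apply: vdisjC; apply: dS; apply: vpos_disj.
have part_le z (p : W) : p = vpos LY (T z) \/ p = vpos LY (- T z) ->
    vle LX (vabs LX (S p)) (vabs LX z).
  have [D E] := Spart z; rewrite {3}E => -[->|->]; first exact: vdisj_le_sum.
  by rewrite -(vabsN _ (S _)) addrC; apply: vdisj_le_sum; apply: vdisjC.
have Sp p q : p = vpos LY u \/ p = vpos LY (- u) -> q = vpos LY v \/ q = vpos LY (- v) ->
    vdisj LX (S p) (S q).
  move=> /part_le px /part_le qy; apply: vdisj_le2 px qy _.
  by rewrite /vdisj !vabs_id.
have [Dv Ev] := Spart (vabs LX y).
have Svp : 0 <=v S (vpos LY v) by apply: vdisj_ge0 Dv _; rewrite -Ev; apply: vabs_ge0.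
have Svn : 0 <=v - S (vpos LY (- v)).
  by apply: vdisj_ge0 (vdisjC Dv) _; rewrite addrC -Ev; apply: vabs_ge0.
have dpos p : p = vpos LY u \/ p = vpos LY (- u) -> vdisj LY p v.
  move=> pE; have p0 : vle LY 0 p by case: pE => ->; apply: vpos_ge0.
  rewrite (vpos_neg LY v); apply: vdisjC; apply: vdisjB; apply: vdisjC.
    apply: (beta_pos_disj TK SK beta NY cpl p0 (vpos_ge0 _ _)) => //.
    by apply: Sp => //; left.
  (* Since [S] maps the negative part of [v] below zero, the positive case is applied to [- T] and
     [- S]. *)
  have nTK : cancel (\- T) (\- S) by move=> z /=; rewrite linearN opprK TK.
  have nSK : cancel (\- S) (\- T) by move=> z /=; rewrite linearN opprK SK.
  have nbeta : cond_beta LX LY (\- T).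
    move=> a b /beta ab; rewrite /= -!scaleN1r; apply: vlhdZ.
    by apply: vlhd_trans ab _; apply: vlhd_abs_le; rewrite scaleN1r vabsN; apply: vle_refl.
  apply: (beta_pos_disj nTK nSK nbeta NY cpl p0 (vpos_ge0 _ _)) => //=.
  apply: vdisjN; apply: vdisjC; apply: vdisjN; apply: vdisjC.
  by apply: Sp => //; right.
by rewrite (vpos_neg LY u); apply: vdisjB; apply: dpos; [left|right].
Qed.
End BetaDisjointnessPreserving.

(** * Completeness and band projections *)

Section Completeness.
Variables (R : realType) (V : lmodType R) (L : archVL V).
Local Notation "x <=v y" := (vle L x y) (at level 70).
Local Notation "`| x |v" := (vabs L x) (format "`| x |v").

(** The norm limit works with the same regulator [e]: the excess of the modulus of [u n - x] over
    [eps *: e] is dominated by that of [u m - x], whose norm is arbitrarily small. *)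
Lemma banach_ru_complete (N : vlnorm L) : norm_complete N -> ru_complete L.
Proof.
move=> cpl u [e [e0 uC]].
(* Adding 1 keeps the divisor positive even when [e] is zero. *)
have ne : 0 < vnorm N e + 1 by rewrite ltr_wpDl ?vnorm_ge0.
have [eps eps0|x xP] := cpl u.
  have [M HM] := uC _ (divr_gt0 eps0 ne); exists M => m n Mm Mn.
  have d0 : 0 <= eps / (vnorm N e + 1) by rewrite divr_ge0 // ltW.
  apply: (@le_lt_trans _ _ (vnorm N ((eps / (vnorm N e + 1)) *: e))).
    by apply: vnorm_lattice; rewrite vabsZ ger0_norm // (vge0_abs e0); apply: HM.
  by rewrite vnormZ ger0_norm // mulrAC ltr_pdivrMr // ltr_pM2l // ltrDl.
exists x, e; split=> // eps eps0; have [M HM] := uC _ eps0; exists M => n Mn.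
suff E : vpos L (`|u n - x|v - eps *: e) = 0.
  by have := vpos_eq0 E => H; apply: (vle_lin H); lmod R.
apply: (@vnorm_eq0 _ _ _ N); apply/eqP; rewrite eq_le vnorm_ge0 andbT.
apply/ler_addgt0Pr => d d0; rewrite add0r; have [M' HM'] := xP _ d0.
pose m := maxn M M'; apply: le_trans (ltW (HM' m (leq_maxr _ _))).
apply: vnorm_lattice; rewrite (vge0_abs (vpos_ge0 _ _)).
apply: vpos_le (vabs_ge0 _ _); have H := HM m n (leq_maxl _ _) Mn.
have H' : `|u n - x|v <=v `|u n - u m|v + `|u m - x|v.
  by rewrite -(subrKA (u m)); apply: vabsD.
by apply: (vle_lin (vle_addb H' H)); lmod R.
Qed.

(** The limit is the supremum of the lower estimates [u (M k) - d k *: e], each of which lies below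
    every upper estimate. *)
Lemma dedekind_sigma_ru_complete : dedekind_sigma_complete L -> ru_complete L.
Proof.
move=> cpl u [e [e0 uC]]; pose d k : R := k.+1%:R^-1.
have d0 k : 0 < d k by rewrite invr_gt0.
have /choice[M HM] k := uC _ (d0 k).
have cross k m : u (M k) - d k *: e <=v u (M m) + d m *: e.
  have [km|/ltnW mk] := leqP (M k) (M m).
    have H := HM k (M m) (M k) km (leqnn _).
    have H' := vle_trans (vle_abs L _) H.
    by apply: (vle_lin (vle_addb H' (vscale_ge0 (ltW (d0 m)) e0))); lmod R.
  have H := HM m (M m) (M k) (leqnn _) mk.
  have H' := vle_trans (vle_abs L _) H.
  by apply: (vle_lin (vle_addb H' (vscale_ge0 (ltW (d0 k)) e0))); lmod R.
have [s [sub sl]] := cpl (fun k => u (M k) - d k *: e) _ (fun k => cross k 0%N).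
have near k : `|u (M k) - s|v <=v d k *: e.
  apply: vabs_le; first by apply: (vle_lin (sub k)); lmod R.
  have H := sl _ (fun j => cross j k).
  by apply: (vle_lin H); lmod R.
exists s, (e *+ 2); split; first exact: vmulrn_ge0.
move=> eps eps0; pose k := Num.bound eps^-1.
have dk : d k <= eps.
  rewrite /d -[eps]invrK lef_pV2 ?posrE ?invr_gt0 ?ltr0n //.
  apply: le_trans (ltW (archi_boundP _)) _; first by rewrite invr_ge0 ltW.
  by rewrite ler_nat.
exists (M k) => n Mn; rewrite -(subrKA (u (M k))); apply: vle_trans (vabsD _ _ _) _.
have := vle_addb (HM k (M k) n (leqnn _) Mn) (near k) => /vle_trans; apply.
by apply: (vle_lin (vscale_le dk (vmulrn_ge0 2 e0))); lmod R.
Qed.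

(** The projection of a positive [x] onto the band of [v] is the supremum [s] of its meets with the
    multiples of the modulus of [v]. *)
Lemma dedekind_sigma_projection : dedekind_sigma_complete L -> forall c v,
  exists2 c1, vlhd L c1 v & vdisj L (c - c1) v.
Proof.
move=> cpl c v.
suff pos_proj x : 0 <=v x -> exists2 x1, vlhd L x1 v & vdisj L (x - x1) v.
  have [p pv dp] := pos_proj _ (vpos_ge0 L c).
  have [q qv dq] := pos_proj _ (vpos_ge0 L (- c)).
  exists (p - q); first exact: vlhdB.
  rewrite {1}(vpos_neg L c) (_ : _ - _ = vpos L c - p - (vpos L (- c) - q)).
    exact: vdisjB.
  by lmod R.
move=> x0; pose y n := vinf L x (`|v|v *+ n).
have y0 n : 0 <=v y n by apply: vinf_ge0 => //; apply: vmulrn_ge0; apply: vabs_ge0.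
have [s [ys sl]] := cpl y x (fun n => vinf_lel _ _ _).
have s0 := vle_trans (y0 0%N) (ys 0%N).
have sx : s <=v x by apply: sl => n; apply: vinf_lel.
(* Both band properties of [s] follow by showing that a meet [d] can be added to every [y n] without
   leaving [s]. *)
have small d : (forall n, y n <=v s - d) -> d <=v 0.
  by move=> /sl H; apply: (vle_lin H); lmod R.
exists s.
  apply/vlhdP => w wv; apply: (@vle_anti _ _ L); last by apply: vinf_ge0; apply: vabs_ge0.
  apply: small => n; set d := vinf L _ _.
  have d0 : 0 <=v d by apply: vinf_ge0; apply: vabs_ge0.
  have H : y n + d <=v s.
    apply: vdisj_lub => //; last by apply: vle_trans (vinf_ler _ _ _) _; rewrite (vge0_abs s0); apply: vle_refl.
    apply: (@vdisj_le2 _ _ _ (`|v|v *+ n) _ w).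
    - rewrite (vge0_abs (y0 n)) (vge0_abs (vmulrn_ge0 n (vabs_ge0 L v))).
      exact: vinf_ler.
    - by rewrite (vge0_abs d0); apply: vinf_lel.
    - by apply: vdisjMn; apply/vdisj_absl; apply: vdisjC.
  by apply: (vle_lin H); lmod R.
have xs0 : 0 <=v x - s by apply: (vle_lin sx); lmod R.
rewrite /vdisj (vge0_abs xs0); set d := vinf L _ _.
have d0 : 0 <=v d by apply: vinf_ge0 => //; apply: vabs_ge0.
apply: (@vle_anti _ _ L) => //; apply: small => n.
suff H : y n + d <=v y n.+1 by apply: (vle_lin (vle_trans H (ys n.+1))); lmod R.
apply: vinf_greatest.
  by apply: (vle_lin (vle_addb (ys n) (vinf_lel L (x - s) `|v|v))); rewrite -/d; lmod R.
rewrite mulrSr; apply: vle_addb; exact: vinf_ler.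
Qed.
End Completeness.

(** * Linear inverses and assembly of the four cases *)

Section Inverse.
Variables (R : realType) (V W : lmodType R) (T : {linear V -> W}).

Lemma linear_inverse : bijective T ->
  exists S : {linear W -> V}, cancel T S /\ cancel S T.
Proof.
move=> [S TK SK].
have S_linear : linear S by exact: can2_linear TK SK.
pose Slin := GRing.isLinear.Build R W V *:%R S S_linear.
pose S' : {linear W -> V} := HB.pack S Slin.
by exists S'.
Qed.
End Inverse.

(* If [b] is [T v], split [T^-1 a] along the band of [v]: the image of the remainder is
   disjoint from [b], hence from [a], of which it is a component. *)
Lemma dp_inverse_beta (R : realType) (V W : lmodType R) (LX : archVL V)
    (LY : archVL W) (T : {linear V -> W}) (S : {linear W -> V}) :
  cancel T S -> cancel S T -> dedekind_sigma_complete LX ->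
  disj_preserving LX LY T -> cond_beta LY LX S.
Proof.
move=> TK SK cpl dT a b /vlhdP ab.
have [c cb dc] := dedekind_sigma_projection cpl (S a) (S b).
suff E : S a - c = 0 by rewrite -[S a](subrK c) E add0r.
have Db : vdisj LY (T (S a - c)) (T (S b)) by apply: dT.
rewrite SK in Db; have Da := ab _ Db.
have Dc : vdisj LY (T c) (T (S a - c)).
  by apply: dT; apply: vdisjC; move/vlhdP: cb; apply.
have D : vdisj LY (T (S a - c)) (T (S a - c)).
  by rewrite {1}linearB SK; apply: vdisjB => //; apply: vdisjC.
by rewrite -[LHS]TK (vdisjxx D) linear0.
Qed.

Lemma ru_normed_dp_iff_beta (R : realType) (V W : lmodType R) (LX : archVL V)
    (LY : archVL W) (T : {linear V -> W}) :
  bijective T -> ru_complete LX -> vlnorm LY ->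
  (disj_preserving LX LY T <-> cond_beta LX LY T).
Proof.
move=> bijT cpl NY; have [S [TK SK]] := linear_inverse bijT.
split=> [dT|]; last exact: (beta_dp TK SK).
apply: (dp_beta TK SK dT) => u v uv.
by apply: (dp_inverse_disj NY dT cpl (can_inj TK)); rewrite !SK.
Qed.

Theorem theorem3p7 (R : realType) :
  (* cases (1)-(3): T : X -> Y *)
  (forall (V W : lmodType R) (LX : archVL V) (LY : archVL W)
      (T : {linear V -> W}),
    bijective T ->
    ( (* (1) X and Y are Banach lattices *)
      (exists (NX : vlnorm LX) (NY : vlnorm LY),
          norm_complete NX /\ norm_complete NY)
      (* (2) X is r_u-complete and Y is a normed vector lattice *)
   \/ (ru_complete LX /\ exists NY : vlnorm LY, True)
      (* (3) X is a Dedekind sigma-complete normed vector lattice and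
             Y is r_u-complete *)
   \/ ((exists NX : vlnorm LX, True) /\ dedekind_sigma_complete LX
        /\ ru_complete LY) ) ->
    (disj_preserving LX LY T <-> cond_beta LX LY T))
  /\
  (* case (4): X is a Dedekind sigma-complete normed vector lattice, Y = X *)
  (forall (V : lmodType R) (LX : archVL V) (T : {linear V -> V}),
    bijective T ->
    (exists NX : vlnorm LX, True) -> dedekind_sigma_complete LX ->
    (disj_preserving LX LX T <-> cond_beta LX LX T)).
Proof.
split=> [V W LX LY T bijT|V LX T bijT [NX _] cpl]; last first.
  exact: ru_normed_dp_iff_beta bijT (dedekind_sigma_ru_complete cpl) NX.
case=> [[NX [NY [cplX _]]]|[[cpl [NY _]]|[[NX _] [sigma cpl]]]].
- exact: ru_normed_dp_iff_beta bijT (banach_ru_complete cplX) NY.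
- exact: ru_normed_dp_iff_beta bijT cpl NY.
(* In case (3) the norm is on the domain, so the results for a normed range are applied to [S]. *)
have [S [TK SK]] := linear_inverse bijT.
split=> [dT|beta].
  apply: (dp_beta TK SK dT); apply: (beta_dp SK TK cpl NX).
  exact: dp_inverse_beta TK SK sigma dT.
move=> x y xy; have dS := beta_inverse_dp TK SK beta.
by apply: (dp_inverse_disj NX dS cpl (can_inj SK)); rewrite !TK.
Qed.
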